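(* Let $N<\infty$ and let $(g_{\gamma_1})_{\gamma_1\in[0,1]}$ be a one-parameter family of noise functions with finitely many non-zero Fourier coefficients, $$ g_{\gamma_1}(x)=1+2\gamma_1\cos x+2\sum_{k=2}^{N}\gamma_k(\gamma_1)\cos kx,\qquad x\in(-\pi,\pi], $$ where the functions $\gamma_1\in[0,1]\mapsto\gamma_k(\gamma_1)\in[-1,1]$, $2\le k\le N$, are $C^2$ and $\gamma_2(\gamma_1)>0$. Consider, in the Maxwellian case, the associated dynamical system for the Fourier coefficients of even densities $f=1+2\sum_{k\ge1}a_k\cos kx$ (so $a_0=1$): $$ \frac{d}{dt}a_k = -a_k+2\gamma_k\Gamma(k/2)a_k+\gamma_k\sum_{n=1}^{k-1}\Gamma(n-k/2)a_na_{k-n}+2\gamma_k\sum_{n=k+1}^{\infty}\Gamma(n-k/2)a_na_{n-k},\qquad k\ge1, $$ with $\gamma_k=\gamma_k(\gamma_1)$ for $2\le k\le N$, $\gamma_k=0$ for $k>N$, and $\Gamma(u)=\frac{\sin(\pi u)}{\pi u}$ ($\Gamma(0)=1$). Then: (i) The uniform distribution, with Fourier coefficients $a_0=1$, $a_k=0$ ($k\ge1$), is stationary. It is (linearly) stable for $\gamma_1<\pi/4$ and unstable for $\gamma_1>\pi/4$. (ii) There is $\gamma_{max}>\pi/4$ such that for every $\gamma_1$ in the interval $\frac\pi4<\gamma_1<\gamma_{max}$ there is another invariant (stationary) solution of the dynamic problem, with Fourier coefficients $a_0=1$, $$ a_1=\sqrt{\frac{12(\gamma_1-\pi/4)}{\pi\,\gamma_2(\pi/4)}}+\mathcal{O}\big((\gamma_1-\pi/4)^{3/2}\big),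 $$ some coefficients $a_2,\dots,a_N$, and $a_k=0$ for $k>N$. (iii) This solution is linearly stable, with leading eigenvalue $$ \lambda(\gamma_1)=1-\frac8\pi\Big(\gamma_1-\frac\pi4\Big)+\mathcal{O}\big((\gamma_1-\pi/4)^{3/2}\big). $$ Here the $\mathcal{O}$ terms refer to $\gamma_1\to\pi/4$ from above.
   Context: The system is the Fourier form of the Boltzmann equation on the circle $$ \partial_t f(t,x)=\int_{-\pi}^{\pi}\int_{-\pi}^{\pi}\Big(f(t,x')f(t,x'+y)g\big(x-x'-\tfrac y2\big)-f(t,x)f(t,x+y)\Big)\frac{dx'}{2\pi}\frac{dy}{2\pi} $$ (Maxwellian case), for even $2\pi$-periodic $f$, with $a_k=\int_{-\pi}^{\pi}f(x)e^{-ikx}\frac{dx}{2\pi}$ and $\gamma_k=\frac1{2\pi}\int_{-\pi}^{\pi}g(z)e^{-ikz}dz$. (The function $g_{\gamma_1}$ is a probability density with respect to $\frac{dx}{2\pi}$ as soon as $g_{\gamma_1}\ge0$.) A stationary solution is a sequence $(a_k)$ for which the right-hand side of the system vanishes for all $k\ge1$; since $\gamma_k=0$ for $k>N$, it satisfies $a_k=0$ for $k>N$. Stability in (i): linearizing at the uniform distribution gives $\frac{d}{dt}b_k=\lambda_kb_k$ with $\lambda_k=2\gamma_k\Gamma(k/2)-1$, $k\geq1$; the uniform distribution is stable if $\lambda_k\le0$ for all $k\ge1$ and unstable otherwise. Stability in (iii): write the system restricted to $\mathbf a=(a_1,\dots,a_N)$ (with $a_k=0$ for $k>N$) as $\frac{d}{dt}\mathbf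 a=Q(\gamma_1:\mathbf a)-\mathbf a$, where $Q_k(\gamma_1:\mathbf a)=2\gamma_k\Gamma(k/2)a_k+\gamma_k\sum_{n=1}^{k-1}\Gamma(n-k/2)a_na_{k-n}+2\gamma_k\sum_{n=k+1}^{N}\Gamma(n-k/2)a_na_{n-k}$. A stationary point $\bar{\mathbf a}(\gamma_1)$ is linearly stable if all eigenvalues of the Jacobian matrix $\frac{\partial}{\partial\mathbf a}Q(\gamma_1:\bar{\mathbf a}(\gamma_1))$ lie inside the (open) unit disc; the leading eigenvalue $\lambda(\gamma_1)$ is the eigenvalue of this Jacobian of largest modulus (the one tending to $1$ as $\gamma_1\to\pi/4$). *)

(* Defs.v *)
From HB Require Import structures.
From mathcomp Require Import all_boot all_order all_algebra complex.
From mathcomp Require Import all_classical all_reals all_analysis.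

Set Implicit Arguments.
Unset Strict Implicit.
Unset Printing Implicit Defensive.

Import Order.TTheory GRing.Theory Num.Theory.
Import numFieldNormedType.Exports.

Local Open Scope classical_set_scope.
Local Open Scope ring_scope.

Section Calculus.
Variable R : realType.
Implicit Types f : R -> R.

(* The increments h are restricted so that x + h stays in [a, b]: the
   derivatives at the end points are the one-sided ones. *)
Definition deriv_on (a b : R) f f' : Prop :=
  forall x, a <= x <= b ->
    h^-1 * (f (x + h) - f x) @[h --> within [set h | a <= x + h <= b] 0^']
      --> f' x.

Definition C2_on (a b : R) f : Prop :=
  exists f' f'' : R -> R,
    [/\ deriv_on a b f f', deriv_on a b f' f''
      & {within `[a, b], continuous f''}].

End Calculus.

Section Boltzmann.
Variable R : realType.

Definition Gam (u : R) : R := if u == 0 then 1 else sin (pi * u) / (pi * u).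

(* Noise coefficients k |-> gamma_k for the parameter value g1 = gamma_1; the
   functions gam k are used for 2 <= k <= N only.  gamma_0 = 1 is the mass of
   the noise; it does not enter the equations, which are for k >= 1. *)
Definition noise_coef (N : nat) (gam : nat -> R -> R) (g1 : R) (k : nat) : R :=
  if k == 0%N then 1
  else if k == 1%N then g1
  else if (k <= N)%N then gam k g1
  else 0.

Definition tail_term (a : nat -> R) (k n : nat) : R :=
  Gam (n%:R - k%:R / 2) * a n * a (n - k)%N.

Definition boltzmann_rhs (c a : nat -> R) (k : nat) : R :=
  - a k + 2 * c k * Gam (k%:R / 2) * a k
  + c k * (\sum_(1 <= n < k) Gam (n%:R - k%:R / 2) * a n * a (k - n)%N)
  + 2 * c k * limn (fun m => \sum_(k.+1 <= n < m) tail_term a k n).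

(* Convergence of the series is required, since limn takes an arbitrary value
   on divergent sequences. *)
Definition stationary (c a : nat -> R) : Prop :=
  a 0%N = 1 /\
  forall k, (1 <= k)%N ->
    cvgn (fun m => \sum_(k.+1 <= n < m) tail_term a k n) /\
    boltzmann_rhs c a k = 0.

Definition uniform_coef (k : nat) : R := (k == 0%N)%:R.

(* The linearization at the uniform distribution is diagonal:
   b_k' = uniform_rate c k * b_k for k >= 1. *)
Definition uniform_rate (c : nat -> R) (k : nat) : R :=
  2 * c k * Gam (k%:R / 2) - 1.

Definition uniform_stable (c : nat -> R) : Prop :=
  forall k, (1 <= k)%N -> uniform_rate c k <= 0.

Definition uniform_unstable (c : nat -> R) : Prop := ~ uniform_stable c.

(* The row vector (a_1, ..., a_N) has a_k at index k - 1. *)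
Definition trunc_vec (N : nat) (a : nat -> R) : 'rV[R]_N := \row_(i < N) a i.+1.

Definition coef_of (N : nat) (v : 'rV[R]_N) (k : nat) : R :=
  if k is j.+1 then (if insub j is Some i then v 0 i else 0) else 1.

Definition Qmap (N : nat) (c : nat -> R) (v : 'rV[R]_N) : 'rV[R]_N :=
  let a := coef_of v in
  \row_(i < N)
    let k := i.+1 in
    (2 * c k * Gam (k%:R / 2) * a k
     + c k * (\sum_(1 <= n < k) Gam (n%:R - k%:R / 2) * a n * a (k - n)%N)
     + 2 * c k * (\sum_(k.+1 <= n < N.+1) Gam (n%:R - k%:R / 2) * a n
                                          * a (n - k)%N)).

(* 'J f p acts on row vectors (it is the transpose of the matrix with entries
   df_i/dx_j), as eigenvalue does; the spectrum is taken in the complex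
   numbers. *)
Definition jacobianQ (N : nat) (c a : nat -> R) : 'M[R[i]]_N :=
  map_mx (real_complex R) ('J (@Qmap N c) (trunc_vec N a)).

Definition linearly_stable (N : nat) (c a : nat -> R) : Prop :=
  forall z : R[i], eigenvalue (jacobianQ N c a) z -> `|z| < 1.

(* Strict domination makes "the eigenvalue of largest modulus" unique. *)
Definition leading_eigenvalue (N : nat) (M : 'M[R[i]]_N) (z : R[i]) : Prop :=
  eigenvalue M z /\ forall w, eigenvalue M w -> w != z -> `|w| < `|z|.

End Boltzmann.

(* Main.v *)
Require Import Defs.
From HB Require Import structures.
From mathcomp Require Import all_boot all_order all_algebra complex.
From mathcomp Require Import all_classical all_reals all_analysis.
From mathcomp Require Import ring lra zify.

Set Implicit Arguments.
Unset Strict Implicit.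
Unset Printing Implicit Defensive.

Import Order.TTheory GRing.Theory Num.Theory.
Import numFieldNormedType.Exports.

Local Open Scope classical_set_scope.
Local Open Scope ring_scope.

(** For even [k] the interaction coefficients vanish except for one square
    term, so that [a_2 = gamma_2 a_1^2], and every mode [k >= 2] is strictly
    damped.  Fixing [a_1 = x], the modes [k >= 2] are therefore slaved to [x] by
    a contraction, with [a_k = O(x^2)] for [k >= 2] and [a_k = O(x^3)] for
    [k >= 3].  With [e = 4/pi (gamma_1 - pi/4)] the remaining equation reads
    [e x - mu x^3 + O(x^5) = 0], solved by the intermediate value theorem.

    The Jacobian at this point is an [O(x)] perturbation of a diagonal matrix
    with entry [1 + e] and all others of modulus at most [2/3]; it has exactly
    one eigenvalue [lam] of modulus at least [5/6].  Its eigenvector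
    [(1, v_2, v_3, ...)] has [lam v_2 = 2 gamma_2 x] and [v_k = O(x^2)] for
    [k >= 3], so [lam = 1 + e - mu x^2 (1 + 2 / lam) + O(x^4)], which is
    [1 - 2 e + O(e^2)] because [mu x^2 = e + O(e^2)]. *)

(** * Row vectors with the maximum norm, and a fixed-point principle *)

HB.instance Definition _ (R : realType) n := Complete.on 'rV[R]_n.

Section VectorTools.
Variable R : realType.

Lemma ler_norm_sum_const (I : finType) (F : I -> R) (t : R) :
  (forall i, `|F i| <= t) -> `|\sum_i F i| <= #|I|%:R * t.
Proof.
move=> Ft; apply: le_trans (ler_norm_sum _ _ _) _.
apply: le_trans (ler_sum _ (fun i _ => Ft i)) _.
by rewrite sumr_const mulr_natl lexx.
Qed.

Lemma rV_coord_le n (v : 'rV[R]_n) i : `|v 0 i| <= `|v|.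
Proof.
rewrite [leRHS]/Num.Def.normr /= mx_normrE.
by apply/bigmax_geP; right => /=; exists (0, i).
Qed.

Lemma rV_norm_le n (v : 'rV[R]_n) (t : R) :
  0 <= t -> (forall i, `|v 0 i| <= t) -> `|v| <= t.
Proof.
move=> t0 vt; rewrite [leLHS]/Num.Def.normr /= mx_normrE.
by apply/bigmax_leP; split => // -[i j] _ /=; rewrite (ord1 i).
Qed.

(** Banach's theorem on a closed ball, which contains 0 and is thus nonempty. It produces both the
    slaved modes and the leading eigenpair. *)
Lemma closed_ball_fixpoint (V : completeNormedModType R) (f : V -> V) (r : R) :
  0 <= r -> (forall u, `|u| <= r -> `|f u| <= r) ->
  (forall u v, `|u| <= r -> `|v| <= r -> `|f u - f v| <= 2^-1 * `|u - v|) ->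
  exists2 u, `|u| <= r & u = f u.
Proof.
move=> r0 fr fl; pose U := closed_ball_ Num.Def.normr (0 : V) r.
have UE u : U u <-> `|u| <= r by rewrite /U /closed_ball_ /= sub0r normrN.
have fU : {homo f : x / U x >-> U x} by move=> u /UE/fr/UE.
have ctr : is_contraction (mkfun_fun fU).
  exists (2^-1)%:nng; split => /=; first by rewrite invf_lt1 ?ltr1n.
  move=> [u v] /= [/UE ur /UE vr]; exact: fl.
have [||u Uu uE] := banach_fixed_point ctr.
- exact: closed_closed_ball_.
- by exists 0; apply/UE; rewrite normr0.
- by exists u => //; apply/UE.
Qed.

End VectorTools.

(** * Estimates for bilinear forms *)

Section QuadraticForms.
Variables (R : realType) (n : nat).
Implicit Types (q : 'I_n -> 'I_n -> R) (u v w : 'rV[R]_n).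

(** The sum runs over pairs, so that a single leading term can be split off by [bigD1]. *)
Definition qform q u v : R :=
  \sum_(p : 'I_n * 'I_n) q p.1 p.2 * u 0 p.1 * v 0 p.2.

Lemma qformDl q u v w : qform q (u + v) w = qform q u w + qform q v w.
Proof.
by rewrite /qform -big_split; apply: eq_bigr => p _; rewrite mxE mulrDr mulrDl.
Qed.

Lemma qformDr q u v w : qform q w (u + v) = qform q w u + qform q w v.
Proof.
by rewrite /qform -big_split; apply: eq_bigr => p _; rewrite mxE mulrDr.
Qed.

Lemma qformZl q (l : R) u v : qform q (l *: u) v = l * qform q u v.
Proof.
rewrite /qform mulr_sumr; apply: eq_bigr => p _.
by rewrite mxE mulrCA !mulrA.
Qed.

Lemma qformZr q (l : R) u v : qform q u (l *: v) = l * qform q u v.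
Proof.
rewrite /qform mulr_sumr; apply: eq_bigr => p _.
by rewrite mxE mulrCA !mulrA.
Qed.

Lemma qform_subsq q u v :
  qform q u u - qform q v v = qform q u (u - v) + qform q (u - v) v.
Proof.
by rewrite qformDr qformDl -(scaleN1r v) qformZl qformZr; ring.
Qed.

(** Isolates the one product of lowest order; all order estimates below rest on it. With [t = 0] it
    becomes an exact formula. *)
Lemma qform_near q u v i0 j0 (t : R) : 0 <= t ->
  (forall i j, (i, j) != (i0, j0) -> `|q i j * u 0 i * v 0 j| <= t) ->
  `|qform q u v - q i0 j0 * u 0 i0 * v 0 j0| <= n%:R ^+ 2 * t.
Proof.
move=> t0 ht; rewrite /qform (bigD1 (i0, j0)) //= addrAC subrr add0r.
apply: le_trans (ler_norm_sum _ _ _) _.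
have -> : n%:R ^+ 2 * t = \sum_(p : 'I_n * 'I_n) t.
  by rewrite sumr_const card_prod !card_ord expr2 -natrM mulr_natl.
rewrite [leRHS](bigD1 (i0, j0)) //= -[leLHS]add0r.
by apply: lerD => //; apply: ler_sum => -[i j] /ht.
Qed.

Lemma qform_le q u v (t : R) :
  (forall i j, `|q i j * u 0 i * v 0 j| <= t) ->
  `|qform q u v| <= n%:R ^+ 2 * t.
Proof.
move=> ht; apply: le_trans (ler_norm_sum_const (fun p => ht p.1 p.2)) _.
by rewrite card_prod !card_ord expr2 -natrM.
Qed.

Lemma qform_le_norm q u v (b : R) : (forall i j, `|q i j| <= b) ->
  `|qform q u v| <= n%:R ^+ 2 * (b * `|u| * `|v|).
Proof.
move=> qb; apply: qform_le => i j; rewrite !normrM.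
by do 2 (apply: ler_pM => //; rewrite ?mulr_ge0 ?rV_coord_le //).
Qed.

Lemma qform_diff_le q u v (b r : R) : `|u| <= r -> `|v| <= r ->
  (forall i j, `|q i j| <= b) ->
  `|qform q u u - qform q v v| <= n%:R ^+ 2 * (2 * b * r * `|u - v|).
Proof.
move=> ur vr qb; rewrite qform_subsq; apply: le_trans (ler_normD _ _) _.
apply: le_trans (lerD (qform_le_norm _ _ qb) (qform_le_norm _ _ qb)) _.
rewrite -mulrDr ler_wpM2l ?sqr_ge0 //.
(* The sign of [b] is read off an entry of [q], so the empty index type is treated apart. *)
have [[i0]|e] := pselect (inhabited 'I_n).
  have b0 : 0 <= b by apply: le_trans (qb i0 i0).
  have := ler_wpM2l b0 ur; have := ler_wpM2l b0 vr.
  by have := normr_ge0 (u - v); nra.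
have -> : u - v = 0 by apply/rowP => i; case: e.
by rewrite normr0 !(mulr0, mul0r) addr0.
Qed.

End QuadraticForms.

(** * Abstract pitchfork systems and their slaved modes *)

Section Branch.
Variables (R : realType) (n : nat).
Local Notation N := n.+2.

Definition snd_index : 'I_N := lift ord0 ord0.

(* The quadratic systems a_k = d_k a_k + sum_ij q_k,ij a_i a_j to which the
   stationary equations reduce, with indices shifted by one: the first
   component is the bifurcating mode, [e] measures the distance to the
   bifurcation point, and all other modes are strictly damped. *)
Record pitchfork (m e s c : R) (d : 'I_N -> R) (q : 'I_N -> 'I_N -> 'I_N -> R)
    : Prop := Pitchfork {
  pf_s : m <= s <= 1;
  pf_c : m <= c <= 1;
  pf_d0 : d ord0 = 1 + e;
  pf_d1 : d snd_index = 0;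
  pf_d : forall k, k != ord0 -> `|d k| <= 2 / 3;
  pf_q : forall k i j, `|q k i j| <= 2;
  pf_q0 : q ord0 snd_index ord0 = - s;
  pf_q0far : forall i j, (i, j) != (snd_index, ord0) ->
    q ord0 i j = 0 \/ (1 < i)%N /\ j != ord0;
  pf_q1 : q snd_index ord0 ord0 = c;
  pf_q1far : forall i j, (i, j) != (ord0, ord0) -> q snd_index i j = 0;
  pf_qk : forall k : 'I_N, (1 < k)%N -> q k ord0 ord0 = 0 }.

Lemma ord_gt1_neq0 (k : 'I_N) : (1 < k)%N -> k != ord0.
Proof. by case: k => -[|[|k]]. Qed.

(** Lyapunov-Schmidt reduction: the equation of the first component is left out and [x] is a free
    parameter. That equation later becomes the scalar bifurcation equation for [x]. *)
Definition slaved (d : 'I_N -> R) q (a : 'rV[R]_N) (x : R) : Prop :=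
  a 0 ord0 = x /\ forall k, k != ord0 -> a 0 k = d k * a 0 k + qform (q k) a a.

Definition size2 : R := N%:R ^+ 2.
(** Makes the slaving map a contraction of ratio 1/2: dividing by [1 - d k] costs a factor 3, the
    difference of two forms with entries at most 2 on the ball of radius [r] costs [4 * size2 * r],
    and [12 * size2 * r = 1 / 2]. *)
Definition branch_radius : R := (24 * size2)^-1.

Lemma size2_ge4 : 4 <= size2.
Proof.
rewrite /size2; have : (2 : R) <= N%:R by rewrite ler_nat.
by move=> h; rewrite expr2; nra.
Qed.

Lemma branch_radiusE : 24 * size2 * branch_radius = 1.
Proof. by rewrite divff //; have := size2_ge4; lra. Qed.

Lemma branch_radius_le t : t <= branch_radius -> 24 * size2 * t <= 1.
Proof.
by move=> tr; rewrite -[leRHS]branch_radiusE ler_wpM2l //; have := size2_ge4; lra.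
Qed.

Lemma branch_radius_gt0 : 0 < branch_radius.
Proof. by rewrite invr_gt0; have := size2_ge4; lra. Qed.

Variables (m e s c : R) (d : 'I_N -> R) (q : 'I_N -> 'I_N -> 'I_N -> R).
Hypothesis pf : pitchfork m e s c d q.

(** The factor 3 comes from [1 - d k >= 1 / 3]. *)
Lemma damped_le k (y z t : R) :
  k != ord0 -> (1 - d k) * y = z -> `|z| <= t -> `|y| <= 3 * t.
Proof.
move=> k0 <-; rewrite normrM; have := pf_d pf k0; rewrite ler_norml => /andP[d1 d2].
rewrite (@ger0_norm _ (1 - d k)); last lra.
by have := normr_ge0 y; nra.
Qed.

Lemma slaved_exists x : 0 <= x <= branch_radius ->
  exists2 a, `|a| <= branch_radius & slaved d q a x.
Proof.
move=> /andP[x0 xr].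
(* Each damped equation is solved for its linear part; the first component is frozen at [x]. *)
pose f (u : 'rV[R]_N) : 'rV[R]_N :=
  \row_k (if k == ord0 then x else qform (q k) u u / (1 - d k)).
have dE k : k != ord0 -> 1 - d k != 0.
  by move=> k0; have := pf_d pf k0; rewrite ler_norml; lra.
have r0 := branch_radius_gt0; have rE := branch_radiusE; have S4 := size2_ge4.
have [|u ur|u v ur vr|u ur uE] := @closed_ball_fixpoint R _ f branch_radius.
- exact: ltW.
- apply: rV_norm_le => [|k]; first exact: ltW.
  rewrite mxE; case: eqVneq => [_|k0]; first by rewrite ger0_norm.
  apply: le_trans (damped_le k0 _ (qform_le_norm u u (pf_q pf k))) _.
    by rewrite mulrC divfK // dE.
  rewrite -/size2; have := normr_ge0 u; have := branch_radius_le ur; nra.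
- apply: rV_norm_le => [|k]; first by rewrite mulr_ge0.
  rewrite !mxE; case: eqVneq => [_|k0]; first by rewrite subrr normr0 mulr_ge0.
  have h := qform_diff_le ur vr (pf_q pf k).
  apply: le_trans (damped_le k0 _ h) _; first by field; exact: dE.
  rewrite -/size2; have := normr_ge0 (u - v); have := branch_radius_le (lexx _).
  nra.
- exists u => //; split; first by rewrite uE mxE.
  move=> k k0; have : (1 - d k) * u 0 k = qform (q k) u u.
    by rewrite [in LHS]uE mxE (negPf k0) mulrC divfK // dE.
  by rewrite mulrBl mul1r => <-; rewrite addrC subrK.
Qed.

Lemma slavedE a x k : slaved d q a x -> k != ord0 ->
  (1 - d k) * a 0 k = qform (q k) a a.
Proof. by move=> [_ ak] k0; rewrite mulrBl mul1r {1}(ak _ k0) addrC addKr. Qed.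

(** On a damped component the quadratic bound [6 * size2 * |a|^2] is at most [|a| / 4], so the
    maximum norm is governed by the first component. *)
Lemma slaved_norm a x : 0 <= x -> `|a| <= branch_radius -> slaved d q a x -> `|a| <= x.
Proof.
move=> x0 ar sa; have [ax _] := sa.
have rE := branch_radiusE; have S4 := size2_ge4.
have : `|a| <= Num.max x (`|a| / 4).
  apply: rV_norm_le => [|k]; first by rewrite le_max x0.
  rewrite le_max; have [->|k0] := eqVneq k ord0; first by rewrite ax ger0_norm // lexx.
  apply/orP; right.
  apply: le_trans (damped_le k0 _ (qform_le_norm a a (pf_q pf k))) _.
    exact: slavedE sa k0.
  by rewrite -/size2; have := normr_ge0 a; have := branch_radius_le ar; nra.
by rewrite le_max => /orP[//|]; have := normr_ge0 a; lra.
Qed.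

Lemma slaved_le1 a x : `|a| <= x -> slaved d q a x ->
  forall k, k != ord0 -> `|a 0 k| <= 6 * size2 * x ^+ 2.
Proof.
move=> ax sa k k0; have S4 := size2_ge4.
apply: le_trans (damped_le k0 _ (qform_le_norm a a (pf_q pf k))) _.
  exact: slavedE sa k0.
have aa := ler_pM (normr_ge0 a) (normr_ge0 a) ax ax.
by rewrite -/size2 expr2; nra.
Qed.

(** Since [q k ord0 ord0 = 0], every product feeding mode [k] has a damped factor, of order
    [x ^+ 2], besides one of order [x]. *)
Lemma slaved_le2 a x : 0 <= x <= branch_radius -> `|a| <= x -> slaved d q a x ->
  forall k : 'I_N, (1 < k)%N -> `|a 0 k| <= (6 * size2) ^+ 2 * x ^+ 3.
Proof.
move=> /andP[x0 xr] ax sa k k1; have S4 := size2_ge4; have rE := branch_radiusE.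
have k0 := ord_gt1_neq0 k1; have a1 := slaved_le1 ax sa.
have h : `|qform (q k) a a - q k ord0 ord0 * a 0 ord0 * a 0 ord0| <=
         size2 * (2 * (6 * size2 * x ^+ 3)).
  apply: qform_near; first by rewrite !mulr_ge0 ?exprn_ge0 //; lra.
  move=> i j ij; rewrite -mulrA 2!normrM.
  apply: ler_pM; rewrite ?mulr_ge0 //; first exact: pf_q pf _ _ _.
  have ai l : `|a 0 l| <= x by apply: le_trans (rV_coord_le _ _) ax.
  have [i0|i0] := eqVneq i ord0.
    have j0 : j != ord0 by move: ij; rewrite xpair_eqE i0 eqxx.
    by have := ler_pM (normr_ge0 _) (normr_ge0 _) (ai i) (a1 _ j0); nra.
  by have := ler_pM (normr_ge0 _) (normr_ge0 _) (a1 _ i0) (ai j); nra.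
rewrite (pf_qk pf) // !mul0r subr0 in h.
apply: le_trans (damped_le k0 _ h) _; last by nra.
exact: slavedE sa k0.
Qed.

(** The second equation has no linear part and a single quadratic term, so the relation is exact. *)
Lemma slaved_snd a x : slaved d q a x -> a 0 snd_index = c * x ^+ 2.
Proof.
move=> [ax ak]; rewrite ak // (pf_d1 pf) mul0r add0r; apply/eqP.
rewrite -subr_eq0 -normr_le0.
have := @qform_near _ _ (q snd_index) a a ord0 ord0 0 (lexx 0).
rewrite mulr0 (pf_q1 pf) ax -mulrA -expr2; apply => i j ij.
by rewrite (pf_q1far pf) // !mul0r normr0.
Qed.

(** The leading product, of the first two components, gives [- s * c * x ^+ 3]. By [pf_q0far] every
    other nonzero term pairs a mode of order [x ^+ 3] with one of order [x ^+ 2]. *)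
Lemma slaved_main a x : 0 <= x <= branch_radius -> `|a| <= x -> slaved d q a x ->
  `|qform (q ord0) a a + s * c * x ^+ 3| <= (6 * size2) ^+ 4 * x ^+ 5.
Proof.
move=> xr ax sa; have S4 := size2_ge4; move: (xr) => /andP[x0 _].
have := @qform_near _ _ (q ord0) a a snd_index ord0
  (2 * ((6 * size2) ^+ 3 * x ^+ 5)).
rewrite (slaved_snd sa) sa.1 (pf_q0 pf) -/size2 => h.
apply: le_trans (le_trans _ (h _ _)) _.
- by rewrite le_eqVlt; apply/orP; left; apply/eqP; congr `|_|; ring.
- by rewrite !mulr_ge0 ?exprn_ge0 //; lra.
- move=> i j ij; have [->|[i1 j0]] := pf_q0far pf ij.
    by rewrite !mul0r normr0 !mulr_ge0 ?exprn_ge0 //; lra.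
  rewrite -mulrA 2!normrM.
  apply: ler_pM; rewrite ?mulr_ge0 //; first exact: pf_q pf _ _ _.
  have := ler_pM (normr_ge0 _) (normr_ge0 _) (slaved_le2 xr ax sa i1)
    (slaved_le1 ax sa j0).
  by move=> /le_trans; apply; rewrite le_eqVlt; apply/orP; left; apply/eqP; ring.
- have -> : (6 * size2) ^+ 4 * x ^+ 5 = 6 * size2 * ((6 * size2) ^+ 3 * x ^+ 5) by ring.
  have : 0 <= (6 * size2) ^+ 3 * x ^+ 5 by rewrite !mulr_ge0 ?exprn_ge0 //; lra.
  by nra.
Qed.

(** The contraction bounds the damped components of [a - b] by half its norm, so the first
    components decide. This gives continuity of the reduced equation in [x]. *)
Lemma slaved_lipschitz a b x y : `|a| <= branch_radius -> `|b| <= branch_radius ->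
  slaved d q a x -> slaved d q b y -> `|a - b| <= `|x - y|.
Proof.
move=> ar br sa sb; have rE := branch_radiusE; have S4 := size2_ge4.
have : `|a - b| <= Num.max `|x - y| (`|a - b| / 2).
  apply: rV_norm_le => [|k]; first by rewrite le_max normr_ge0.
  rewrite le_max !mxE; have [->|k0] := eqVneq k ord0.
    by rewrite sa.1 sb.1 lexx.
  apply/orP; right.
  have h := qform_diff_le ar br (pf_q pf k).
  apply: le_trans (damped_le k0 _ h) _.
    by rewrite -(slavedE sa k0) -(slavedE sb k0) mulrBr.
  rewrite -/size2; have := normr_ge0 (a - b); have := branch_radius_le (lexx _).
  by nra.
by rewrite le_max => /orP[//|]; have := normr_ge0 (a - b); have := normr_ge0 (x - y); lra.
Qed.

End Branch.

(** * Solving the bifurcation equation by the intermediate value theorem *)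

Section Existence.
Variable R : realType.

Lemma lipschitz_within_continuous (f : R -> R) (a b L : R) : 0 < L ->
  (forall x y, a <= x <= b -> a <= y <= b -> `|f x - f y| <= L * `|x - y|) ->
  {within `[a, b], continuous f}.
Proof.
move=> L0 fL; apply/subspace_continuousP => x; rewrite /= in_itv /= => xab.
apply/cvgrPdist_le => /= e e0; rewrite near_withinE.
near=> y; rewrite /= in_itv /= => yab; apply: le_trans (fL _ _ xab yab) _.
rewrite mulrC -ler_pdivlMr //; near: y.
by apply: cvgr_dist_le => //; rewrite divr_gt0.
Unshelve. all: by end_near. Qed.

(** A common constant for the errors of the bifurcation equation, where [(6 * size2) ^+ 4] occurs,
    and of the eigenvalue equation. *)
Definition remainder n : R := (24 * size2 R n) ^+ 4.

Lemma remainder_gt0 n : 0 < remainder n.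
Proof. by rewrite exprn_gt0 //; have := size2_ge4 R n; lra. Qed.

Lemma remainder_ge1 n : 1 <= remainder n.
Proof. by rewrite exprn_ege1 //; have := size2_ge4 R n; lra. Qed.

(** Makes [remainder * e] small against [(s * c) ^+ 2 >= m ^+ 4]. The factor 100 also keeps the
    leading eigenvalue below 1 later on. *)
Definition branch_range n (m : R) : R := m ^+ 4 / (100 * remainder n).

Lemma branch_range_gt0 n (m : R) : 0 < m -> 0 < branch_range n m.
Proof.
by move=> m0; rewrite divr_gt0 ?mulr_gt0 ?exprn_gt0 ?remainder_gt0.
Qed.

Lemma pitchfork_branch n (m e s c : R) (d : 'I_n.+2 -> R)
    (q : 'I_n.+2 -> 'I_n.+2 -> 'I_n.+2 -> R) :
  0 < m -> 0 < e < branch_range n m -> pitchfork m e s c d q ->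
  exists (a : 'rV[R]_n.+2) (x : R),
    [/\ 0 < x <= branch_radius R n, `|a| <= x, slaved d q a x,
    e * x + qform (q ord0) a a = 0 & x ^+ 2 <= 2 * e / m ^+ 2
      /\ remainder n * x ^+ 2 <= 1].
Proof.
move=> m0 /andP[e0]; rewrite /branch_range => eT pf.
have [/andP[ms s1] /andP[mc c1]] := (pf_s pf, pf_c pf).
set r := branch_radius R n ; set T := remainder n in eT *.
have T0 : 0 < T := remainder_gt0 n.
have r0 : 0 < r := branch_radius_gt0 R n.
pose mu := s * c.
have mu0 : 0 < mu by rewrite mulr_gt0 //; lra.
have mmu : m ^+ 2 <= mu by rewrite expr2 ler_pM //; lra.
have m20 : 0 < m ^+ 2 by rewrite exprn_gt0.
(* A slaved vector is selected for each [x]; for [x] outside [[0, r]] its properties are not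
   asserted. *)
pose A x := get [set a : 'rV[R]_n.+2 | `|a| <= r /\ slaved d q a x].
have AP x : 0 <= x <= r -> `|A x| <= r /\ slaved d q (A x) x.
  move=> xr; have [a ar sa] := slaved_exists pf xr.
  exact: (@getPex _ [set a : 'rV[R]_n.+2 | `|a| <= r /\ slaved d q a x]
    (ex_intro _ a (conj ar sa))).
pose h x := e * x + qform (q ord0) (A x) (A x).
(* The approximate root has [x ^+ 2 = e / mu]; the bracket takes half and twice this value. *)
pose x1 := Num.sqrt (e / (2 * mu)); pose x2 := Num.sqrt (2 * e / mu).
have x1E : x1 ^+ 2 = e / (2 * mu).
  by rewrite sqr_sqrtr // ltW // divr_gt0 // mulr_gt0.
have x2E : x2 ^+ 2 = 2 * e / mu by rewrite sqr_sqrtr // ltW // divr_gt0 // mulr_gt0.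
have x10 : 0 < x1 by rewrite sqrtr_gt0 divr_gt0 // mulr_gt0.
have x20 : 0 < x2 by rewrite sqrtr_gt0 divr_gt0 // mulr_gt0.
have x2le : x2 ^+ 2 <= 2 * e / m ^+ 2.
  by rewrite x2E ler_wpM2l ?lef_pV2 ?posrE //; lra.
have x12 : x1 <= x2.
  rewrite ler_wsqrtr //.
  have -> : e / (2 * mu) = 4^-1 * (2 * e / mu) by field; rewrite gt_eqF.
  have : 0 < 2 * e / mu by rewrite divr_gt0 // mulr_gt0.
  by lra.
have Tx2 : T * x2 ^+ 2 <= 1.
  apply: le_trans (ler_wpM2l (ltW T0) x2le) _.
  rewrite mulrA ler_pdivrMr // mul1r.
  have m4 : m ^+ 4 <= m ^+ 2 by rewrite ler_wiXn2l //; lra.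
  by move: eT; rewrite ltr_pdivlMr ?mulr_gt0 //; lra.
have x2r : x2 <= r.
  have S4 := size2_ge4 R n; have rE : 24 * size2 R n * r = 1 := branch_radiusE R n.
  rewrite -(@ler_pXn2r _ 2) ?nnegrE ?(ltW x20) ?(ltW r0) //.
  rewrite -(ler_pM2l T0); apply: le_trans Tx2 _.
  have -> : T * r ^+ 2 = (24 * size2 R n * r) ^+ 2 * (24 * size2 R n) ^+ 2.
    by rewrite /T /remainder; ring.
  by rewrite rE expr1n mul1r exprn_ege1 //; lra.
have hE x : 0 <= x <= r -> `|h x - x * (e - mu * x ^+ 2)| <= T * x ^+ 5.
  move=> xr; have [ar sa] := AP _ xr; move/andP: (xr) => [x0 _].
  have -> : h x - x * (e - mu * x ^+ 2) =
      qform (q ord0) (A x) (A x) + s * c * x ^+ 3 by rewrite /h /mu; ring.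
  apply: le_trans (slaved_main pf xr (slaved_norm pf x0 ar sa) sa) _.
  have S4 := size2_ge4 R n.
  by rewrite ler_wpM2r ?exprn_ge0 // ler_pXn2r ?nnegrE //; lra.
(* The main term has relative size [e * (1 - t)] and the error at most [e * t / 2]. At [t = 1 / 2]
   the main term wins; at [t = 2] the two balance, which still gives [h x2 <= 0]. *)
have sgn x t : 0 < x <= r -> x ^+ 2 = t * (e / mu) -> 0 < t <= 2 ->
    `|h x - x * (e * (1 - t))| <= x * (e / 2 * t).
  move=> /andP[x0 xr] xE /andP[t0 t2]; have xr' : 0 <= x <= r by rewrite ltW.
  have -> : x * (e * (1 - t)) = x * (e - mu * x ^+ 2).
    by rewrite xE; field; rewrite gt_eqF.
  apply: le_trans (hE _ xr') _.
  have -> : T * x ^+ 5 = x * (T * (x ^+ 2) ^+ 2) by ring.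
  rewrite ler_wpM2l ?(ltW x0) // xE.
  have w0 : 0 < e / mu by rewrite divr_gt0.
  have Tw : T * (e / mu) ^+ 2 <= e / 4.
    have -> : T * (e / mu) ^+ 2 = e * (T * e / mu ^+ 2).
      by field; rewrite gt_eqF.
    rewrite ler_pM2l // ler_pdivrMr ?exprn_gt0 //.
    have : m ^+ 4 <= mu ^+ 2.
      have -> : m ^+ 4 = (m ^+ 2) ^+ 2 by rewrite -exprM.
      by rewrite ler_pXn2r ?nnegrE ?(ltW m20) ?(ltW mu0).
    have := sqr_ge0 mu; move: eT; rewrite ltr_pdivlMr ?mulr_gt0 //.
    by lra.
  rewrite exprMn mulrCA; have t20 : 0 < t ^+ 2 by rewrite exprn_gt0.
  apply: le_trans (ler_wpM2l (ltW t20) Tw) _.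
  by rewrite expr2; have := mulr_gt0 e0 t0; nra.
have hx1 : 0 <= h x1.
  have := @sgn x1 (1 / 2); rewrite ler_norml => /(_ _ _ _)/andP[].
  - by apply/andP; split; lra.
  - by rewrite x1E; field; rewrite gt_eqF.
  - by apply/andP; split; lra.
  by have := mulr_gt0 x10 e0; lra.
have hx2 : h x2 <= 0.
  have := @sgn x2 2; rewrite ler_norml => /(_ _ _ _)/andP[].
  - by apply/andP; split; lra.
  - by rewrite x2E; field; rewrite gt_eqF.
  - by apply/andP; split; lra.
  by have := mulr_gt0 x20 e0; lra.
have hc : {within `[x1, x2], continuous h}.
  apply: (@lipschitz_within_continuous _ _ _ (e + 1)); first lra.
  move=> x y /andP[xl xu] /andP[yl yu].
  have [|ar sa] := AP x; first by apply/andP; split; lra.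
  have [|br sb] := AP y; first by apply/andP; split; lra.
  have -> : h x - h y = e * (x - y) +
      (qform (q ord0) (A x) (A x) - qform (q ord0) (A y) (A y)).
    by rewrite /h; ring.
  apply: le_trans (ler_normD _ _) _; rewrite normrM gtr0_norm // mulrDl lerD //.
  apply: le_trans (qform_diff_le ar br (pf_q pf ord0)) _.
  have := slaved_lipschitz pf ar br sa sb.
  have := branch_radius_le (lexx (branch_radius R n)); rewrite -/(size2 R n) -/r.
  have := size2_ge4 R n; have := normr_ge0 (A x - A y).
  set S := size2 R n; set w := `|A x - A y| => w0 S4 Sr wxy.
  by rewrite mul1r; apply: le_trans wxy; nra.
have [|x] := IVT (v := 0) x12 hc.
  by rewrite ge_min le_max hx1 hx2 orbT.
rewrite in_itv /= => /andP[xl xu] hx.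
have xr : 0 <= x <= r by apply/andP; split; lra.
have [ar sa] := AP _ xr.
exists (A x), x; split => //.
- by apply/andP; split; lra.
- by apply: (slaved_norm pf _ ar sa); lra.
- have xx2 : x ^+ 2 <= x2 ^+ 2 by rewrite ler_pXn2r ?nnegrE //; lra.
  split; first exact: le_trans x2le.
  by apply: le_trans Tx2; rewrite ler_pM2l.
Qed.

End Existence.

(** * The leading eigenpair and its expansion *)

(** Two passes. First [lam * w = - 2 M] gives [|lam - 1| <= 5 * y]. Then, with [t = e - M + rho],
    the identity [lam - (1 - 2 e) = 2 (e - M) + lam * t - (lam - 1)^2] has right-hand side bounded
    by [(2 + 13 / 6 + 25) * X]. *)
Lemma eigenvalue_expansion (R : realType) (lam e M rho X y : R) :
  23 / 24 <= lam <= 13 / 12 -> 0 <= M <= y -> X <= y -> y ^+ 2 <= X ->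
  `|e - M| <= X -> `|rho| <= X ->
  lam * (lam - 1) = lam * (e - M + rho) - 2 * M ->
  `|lam - (1 - 2 * e)| <= 31 * X.
Proof.
move=> /andP[l1 l2] /andP[M0 My] Xy yX; rewrite !ler_norml.
move=> /andP[d1 d2] /andP[r1 r2] zE.
pose t := e - M + rho; pose w := lam - 1 - t.
have wE : lam * w = - (2 * M) by rewrite mulrBr zE /t; ring.
have w0 : w <= 0 by rewrite -(@pmulr_rle0 _ lam) ?wE; lra.
have w3 : - (3 * M) <= w by clear - wE w0 l1 M0; nra.
have z5 : `|lam - 1| <= 5 * y by rewrite ler_norml /w /t in w0 w3 *; lra.
have z25 : (lam - 1) ^+ 2 <= 25 * X.
  rewrite -real_normK ?num_real //.
  have := ler_pM (normr_ge0 _) (normr_ge0 _) z5 z5; rewrite -expr2 => /le_trans.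
  by apply; rewrite (_ : 5 * y * (5 * y) = 25 * y ^+ 2); [lra | ring].
have lt3 : `|lam * t| <= 13 / 12 * (2 * X).
  by rewrite normrM ler_pM // ler_norml /t; lra.
have -> : lam - (1 - 2 * e) = 2 * (e - M) + lam * t - (lam - 1) ^+ 2.
  by have -> : lam * t = lam * (lam - 1) + 2 * M; [rewrite zE subrK | ring].
have := sqr_ge0 (lam - 1); move: lt3; rewrite ler_norml; lra.
Qed.

Section LeadingEigenpair.
Variables (R : realType) (n : nat).
Local Notation N := n.+2.
Local Notation S := (size2 R n).
Variables (m e s c : R) (d : 'I_N -> R) (q : 'I_N -> 'I_N -> 'I_N -> R).
Hypothesis pf : pitchfork m e s c d q.
Variables (a : 'rV[R]_N) (x : R).
Hypothesis x0 : 0 < x.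
Hypothesis ax : `|a| <= x.
Hypothesis sa : slaved d q a x.
Hypothesis Tx : remainder R n * x ^+ 2 <= 1.

(** The derivative of [v |-> qform (q k) v v] at [a], applied to [v]. *)
Definition lform (k : 'I_N) (v : 'rV[R]_N) : R :=
  qform (q k) a v + qform (q k) v a.

Lemma lformB k v w : lform k (v - w) = lform k v - lform k w.
Proof.
rewrite /lform -(scaleN1r w) qformDl qformDr qformZl qformZr; ring.
Qed.

Lemma lform_le k v : `|lform k v| <= 4 * S * x * `|v|.
Proof.
apply: le_trans (ler_normD _ _) _.
apply: le_trans (lerD (qform_le_norm _ _ (pf_q pf k))
                      (qform_le_norm _ _ (pf_q pf k))) _.
have S4 := size2_ge4 R n; rewrite -/S.
have := ler_wpM2r (normr_ge0 v) ax; have := normr_ge0 v; nra.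
Qed.

Lemma lform_near k i0 j0 (v : 'rV[R]_N) (t : R) : 0 <= t ->
  (forall i j, (i, j) != (i0, j0) -> q k i j = 0 \/
     `|a 0 i| * `|v 0 j| <= t /\ `|v 0 i| * `|a 0 j| <= t) ->
  `|lform k v - q k i0 j0 * (a 0 i0 * v 0 j0 + v 0 i0 * a 0 j0)| <= 4 * S * t.
Proof.
move=> t0 ht.
have -> : lform k v - q k i0 j0 * (a 0 i0 * v 0 j0 + v 0 i0 * a 0 j0) =
   (qform (q k) a v - q k i0 j0 * a 0 i0 * v 0 j0) +
   (qform (q k) v a - q k i0 j0 * v 0 i0 * a 0 j0) by rewrite /lform; ring.
have -> : 4 * S * t = S * (2 * t) + S * (2 * t) by ring.
apply: le_trans (ler_normD _ _) (lerD _ _).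
- apply: qform_near => [|i j ij]; first by rewrite mulr_ge0.
  have [->|[h _]] := ht _ _ ij; first by rewrite !mul0r normr0 mulr_ge0.
  by rewrite -mulrA 2!normrM ler_pM ?mulr_ge0 ?(pf_q pf).
- apply: qform_near => [|i j ij]; first by rewrite mulr_ge0.
  have [->|[_ h]] := ht _ _ ij; first by rewrite !mul0r normr0 mulr_ge0.
  by rewrite -mulrA 2!normrM ler_pM ?mulr_ge0 ?(pf_q pf).
Qed.

Lemma small_x : 384 * S * x <= 1.
Proof.
have S4 := size2_ge4 R n.
have h : (24 * S) ^+ 2 * x <= 1.
  have h0 : 0 <= (24 * S) ^+ 2 * x := mulr_ge0 (sqr_ge0 _) (ltW x0).
  rewrite -(@ler_pXn2r _ 2) ?nnegrE // expr1n.
  by have -> : ((24 * S) ^+ 2 * x) ^+ 2 = remainder R n * x ^+ 2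
    by rewrite /remainder; ring.
by apply: le_trans h; rewrite ler_pM2r // expr2; nra.
Qed.

(** The bifurcation equation divided by [x]. *)
Lemma small_e : e * x + qform (q ord0) a a = 0 -> 0 <= x <= branch_radius R n ->
  `|e - s * c * x ^+ 2| <= remainder R n * x ^+ 4.
Proof.
move=> ex xr; have S4 := size2_ge4 R n.
rewrite -(ler_pM2l x0) [leLHS](_ : _ = `|x * (e - s * c * x ^+ 2)|); last first.
  by rewrite normrM (gtr0_norm x0).
have -> : x * (e - s * c * x ^+ 2) = - (qform (q ord0) a a + s * c * x ^+ 3).
  have -> : qform (q ord0) a a = - (e * x) by apply/eqP; rewrite -addr_eq0 addrC ex.
  by ring.
rewrite normrN; apply: le_trans (slaved_main pf xr ax sa) _.
have -> : x * (remainder R n * x ^+ 4) = remainder R n * x ^+ 5 by ring.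
by rewrite ler_wpM2r ?exprn_ge0 ?(ltW x0) // ler_pXn2r ?nnegrE //; lra.
Qed.

Hypothesis m_ge0 : 0 <= m.
Hypothesis e0 : 0 < e < 24^-1.

Definition eigenpair (lam : R) (v : 'rV[R]_N) : Prop :=
  v 0 ord0 = 1 /\ forall k, lam * v 0 k = d k * v 0 k + lform k v.

(* In the unknowns (lam - d_0, v_1, ..., v_{N-1}), with v_0 = 1, the eigenvalue
   equation is a small quadratic fixed point problem. *)
Lemma eigenpair_exists : exists (lam : R) (v : 'rV[R]_N),
  [/\ eigenpair lam v, `|lam - (1 + e)| <= 24^-1 & forall k, `|v 0 k| <= 1].
Proof.
have S4 := size2_ge4 R n; have Sx := small_x; case/andP: e0 => e1 e2.
(* The slot [ord0] of [w] stores [lam - d ord0]; [ext] overwrites it with the normalization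
   [v_0 = 1]. *)
pose ext (w : 'rV[R]_N) : 'rV[R]_N := \row_k (if k == ord0 then 1 else w 0 k).
pose f (w : 'rV[R]_N) : 'rV[R]_N := \row_k (if k == ord0 then lform ord0 (ext w)
  else (lform k (ext w) - w 0 ord0 * w 0 k) / (d ord0 - d k)).
have ext_le w : `|w| <= 24^-1 -> `|ext w| <= 1.
  move=> w1; apply: rV_norm_le => // k; rewrite mxE; case: ifP => _.
    by rewrite normr1.
  by apply: le_trans (rV_coord_le _ _) _; lra.
have extB w w' : `|ext w - ext w'| <= `|w - w'|.
  apply: rV_norm_le => // k; rewrite !mxE; case: ifP => _.
    by rewrite subrr normr0.
  by have := rV_coord_le (w - w') k; rewrite !mxE.
have dE k : k != ord0 -> 3^-1 <= d ord0 - d k.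
  by move=> k0; have := pf_d pf k0; rewrite (pf_d0 pf) ler_norml; lra.
have div_le k (y t : R) : k != ord0 -> `|y| <= t -> `|y / (d ord0 - d k)| <= 3 * t.
  move=> /dE h yt; rewrite normrM normfV (@ger0_norm _ (d ord0 - d k)); last lra.
  by rewrite ler_pdivrMr; [have := normr_ge0 y; nra | lra].
have [||w w'|w wr wE] := @closed_ball_fixpoint R _ f 24^-1.
- by rewrite invr_ge0.
- move=> w wr; apply: rV_norm_le => [|k]; first by rewrite invr_ge0.
  have lw k' : `|lform k' (ext w)| <= 96^-1.
    apply: le_trans (lform_le _ _) _.
    by have := ext_le _ wr; have := normr_ge0 (ext w); nra.
  rewrite mxE; case: eqVneq => [_|k0]; first by have := lw ord0; lra.
  have h : `|lform k (ext w) - w 0 ord0 * w 0 k| <= 96^-1 + 24^-1 * 24^-1.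
    apply: le_trans (ler_normB _ _) (lerD (lw k) _).
    by rewrite normrM ler_pM // (le_trans (rV_coord_le _ _)).
  by apply: le_trans (div_le _ _ _ k0 h) _; lra.
- move=> wr wr'; apply: rV_norm_le => [|k]; first by rewrite mulr_ge0.
  have lw k' : `|lform k' (ext w) - lform k' (ext w')| <= 96^-1 * `|w - w'|.
    rewrite -lformB; apply: le_trans (lform_le _ _) _.
    have := extB w w'; have := normr_ge0 (ext w - ext w'); nra.
  have ww0 := normr_ge0 (w - w').
  rewrite !mxE; case: eqVneq => [_|k0]; first by have := lw ord0; lra.
  rewrite -mulrBl.
  have h : `|lform k (ext w) - w 0 ord0 * w 0 k -
      (lform k (ext w') - w' 0 ord0 * w' 0 k)| <= (96^-1 + 12^-1) * `|w - w'|.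
    have -> : lform k (ext w) - w 0 ord0 * w 0 k -
      (lform k (ext w') - w' 0 ord0 * w' 0 k) =
      (lform k (ext w) - lform k (ext w')) -
      (w 0 ord0 * (w - w') 0 k + (w - w') 0 ord0 * w' 0 k).
      by rewrite !mxE; ring.
    apply: le_trans (ler_normB _ _) _; rewrite mulrDl lerD //.
    apply: le_trans (ler_normD _ _) _; rewrite !normrM.
    have c1 := le_trans (rV_coord_le w ord0) wr.
    have c2 := le_trans (rV_coord_le w' k) wr'.
    have c3 := rV_coord_le (w - w') k; have c4 := rV_coord_le (w - w') ord0.
    have h1 := ler_pM (normr_ge0 _) (normr_ge0 _) c1 c3.
    have h2 := ler_pM (normr_ge0 _) (normr_ge0 _) c4 c2.
    by apply: le_trans (lerD h1 h2) _; lra.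
  by apply: le_trans (div_le _ _ _ k0 h) _; lra.
- have w0E : w 0 ord0 = lform ord0 (ext w) by rewrite [in LHS]wE mxE.
  exists (d ord0 + w 0 ord0), (ext w); split.
  + split=> [|k]; first by rewrite mxE.
    have [->|k0] := eqVneq k ord0; first by rewrite w0E mxE /=; ring.
    have : (d ord0 - d k) * w 0 k = lform k (ext w) - w 0 ord0 * w 0 k.
      by rewrite [in LHS]wE mxE (negPf k0) mulrC divfK //; have := dE _ k0; lra.
    move=> /eqP; rewrite eq_sym subr_eq => /eqP ->.
    by rewrite mxE (negPf k0); ring.
  + by rewrite (pf_d0 pf) addrAC subrr add0r (le_trans (rV_coord_le _ _)).
  + by move=> k; apply: le_trans (rV_coord_le _ _) (ext_le _ wr).
Qed.

Lemma eigenpair_asymp lam (v : 'rV[R]_N) : e * x + qform (q ord0) a a = 0 ->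
  0 <= x <= branch_radius R n -> eigenpair lam v ->
  `|lam - (1 + e)| <= 24^-1 -> (forall k, `|v 0 k| <= 1) ->
  `|lam - (1 - 2 * e)| <= 31 * remainder R n * x ^+ 4.
Proof.
move=> ex xr [v0 vk] lame v1; have Sx := small_x; case/andP: e0 => e1 e2.
have S4 := size2_ge4 R n; move: lame; rewrite ler_norml => /andP[l1 l2].
have lam_gt : 23 / 24 <= lam by lra.
have lam_lt : lam <= 13 / 12 by lra.
have x2_ge0 := sqr_ge0 x.
have vn : `|v| <= 1 by exact: rV_norm_le.
(* The factor 6 comes from [lam - d k >= 23 / 24 - 2 / 3 > 1 / 6]. *)
have v_le k (t : R) : k != ord0 -> `|lform k v| <= t -> `|v 0 k| <= 6 * t.
  move=> k0; have -> : lform k v = (lam - d k) * v 0 k.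
    by rewrite mulrBl vk addrC addKr.
  have := pf_d pf k0; rewrite ler_norml normrM => /andP[d1 d2].
  rewrite (@ger0_norm _ (lam - d k)); last lra.
  by have := normr_ge0 (v 0 k); nra.
have vle1 k : k != ord0 -> `|v 0 k| <= 24 * S * x.
  move=> k0; apply: le_trans (v_le _ _ k0 (lform_le _ _)) _.
  rewrite (_ : 24 * S * x = 6 * (4 * S * x * 1)); last by ring.
  by rewrite ler_pM2l // ler_wpM2l // !mulr_ge0 ?(ltW x0) //; lra.
have aX k : `|a 0 k| <= x by apply: le_trans (rV_coord_le _ _) ax.
have ale1 := slaved_le1 pf ax sa.
have ale2 := slaved_le2 pf xr ax sa.
(* The pair of first components has coefficient 0. Any other product has a damped factor: a
   component of [v], of order [x], against [a_i] of order [x], or a component of [a], of order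
   [x ^+ 2], against a bounded one of [v]. *)
have vle2 (k : 'I_N) : (1 < k)%N -> `|v 0 k| <= (24 * S) ^+ 2 * x ^+ 2.
  move=> k1; have k0 := ord_gt1_neq0 k1.
  have := @lform_near k ord0 ord0 v (24 * S * x ^+ 2).
  rewrite (pf_qk pf) // mul0r subr0 => /(_ _ _) h.
  have -> : (24 * S) ^+ 2 * x ^+ 2 = 6 * (4 * S * (24 * S * x ^+ 2)) by ring.
  apply: v_le k0 (h _ _).
  - by rewrite !mulr_ge0 //; lra.
  - have P (i j : 'I_N) : (i, j) != (ord0, ord0) ->
        `|a 0 i| * `|v 0 j| <= 24 * S * x ^+ 2.
      move=> ij; have [i0|i0] := eqVneq i ord0.
        have j0 : j != ord0 by move: ij; rewrite xpair_eqE i0 eqxx.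
        have := ler_pM (normr_ge0 _) (normr_ge0 _) (aX i) (vle1 _ j0).
        by move=> /le_trans; apply; rewrite mulrCA -expr2.
      have := ler_pM (normr_ge0 _) (normr_ge0 _) (ale1 _ i0) (v1 j).
      move=> /le_trans; apply; rewrite mulr1 ler_wpM2r // ler_wpM2r //; lra.
    move=> i j ij; right; split; first exact: P.
    by rewrite mulrC; apply: P; move: ij; rewrite !xpair_eqE andbC.
have v1E : lam * v 0 (snd_index n) = 2 * c * x.
  rewrite vk (pf_d1 pf) mul0r add0r; apply/eqP; rewrite -subr_eq0 -normr_le0.
  have := @lform_near (snd_index n) ord0 ord0 v 0 (lexx 0).
  rewrite mulr0 (pf_q1 pf) v0 sa.1 => h.
  have -> : 2 * c * x = c * (x * 1 + 1 * x) by ring.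
  by apply: h => i j ij; left; exact: pf_q1far pf _ _ ij.
have L0 : `|lform ord0 v + s * (c * x ^+ 2 + v 0 (snd_index n) * x)| <=
    remainder R n * x ^+ 4.
  have P0 k l : 0 <= (24 * S) ^+ k * x ^+ l.
    by rewrite mulr_ge0 // exprn_ge0 //; [lra | exact: ltW].
  have := @lform_near ord0 (snd_index n) ord0 v ((24 * S) ^+ 3 * x ^+ 4) (P0 _ _).
  rewrite (pf_q0 pf) (slaved_snd pf sa) v0 sa.1 mulNr opprK mulr1 => h.
  apply: le_trans (h _) _.
    move=> i j ij; have [|[i1 j0]] := pf_q0far pf ij; first by left.
    right; split.
      have := ler_pM (normr_ge0 _) (normr_ge0 _) (ale2 _ i1) (vle1 _ j0).
      move=> /le_trans; apply.
      rewrite (_ : _ * _ = 16^-1 * ((24 * S) ^+ 3 * x ^+ 4)); last by field.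
      by have := P0 3 4; lra.
    have := ler_pM (normr_ge0 _) (normr_ge0 _) (vle2 _ i1) (ale1 _ j0).
    move=> /le_trans; apply.
    rewrite (_ : _ * _ = 4^-1 * ((24 * S) ^+ 3 * x ^+ 4)); last by field.
    by have := P0 3 4; lra.
  rewrite (_ : 4 * S * _ = 6^-1 * ((24 * S) ^+ 4 * x ^+ 4)); last by field.
  by have := P0 4 4; rewrite /remainder; lra.
have E0 := small_e ex xr.
move: L0 E0 Tx; set T := remainder R n => L0 E0 Tx'.
have T1 : 1 <= T := remainder_ge1 R n.
have lamE : lam = 1 + e + lform ord0 v.
  by have := vk ord0; rewrite v0 !mulr1 (pf_d0 pf).
pose M := s * c * x ^+ 2; pose z := lam - 1.
pose rho := lform ord0 v + s * (c * x ^+ 2 + v 0 (snd_index n) * x).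
(* Multiplying by [lam] turns the second component of [v] into the explicit [2 * c * x]. *)
have zE : lam * z = lam * ((e - M) + rho) - 2 * M.
  have -> : lam * (e - M + rho) - 2 * M =
     lam * (lform ord0 v + e) + s * x * (lam * v 0 (snd_index n) - 2 * c * x).
    by rewrite /rho /M; ring.
  by rewrite v1E subrr mulr0 addr0 /z {2}lamE; ring.
have [m0 [/andP[s0 s1] /andP[c0 c1]]] := (m_ge0, (pf_s pf, pf_c pf)).
have /andP[M0 Mx] : 0 <= M <= x ^+ 2.
  have sc0 : 0 <= s * c by rewrite mulr_ge0 //; lra.
  by rewrite mulr_ge0 // ler_piMl // mulr_ile1 //; lra.
have X4 : T * x ^+ 4 <= x ^+ 2.
  have -> : T * x ^+ 4 = T * x ^+ 2 * x ^+ 2 by ring.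
  by rewrite ler_piMl.
have xT : x ^+ 4 <= T * x ^+ 4 by rewrite ler_peMl // exprn_ge0 // ltW.
rewrite -mulrA; apply: (@eigenvalue_expansion _ _ _ M rho _ (x ^+ 2)) => //.
- by rewrite lam_gt.
- by rewrite M0.
- by rewrite -exprM.
Qed.

End LeadingEigenpair.

(** * Complex eigenvalues of a near-diagonal real matrix *)

Section DominantEigenvalue.
Variable R : realType.
Local Notation normc := (@ComplexField.Normc.normc R).

Lemma normc_ge0 (z : R[i]) : 0 <= normc z.
Proof. by case: z => a b; rewrite /= sqrtr_ge0. Qed.

Lemma normc_real (x : R) : normc (real_complex R x) = `|x|.
Proof. by rewrite /= expr0n /= addr0 sqrtr_sqr. Qed.

(** The norm of [R[i]] takes values in [R[i]]; estimates are made with the real-valued [normc] and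
    transferred by this identity. *)
Lemma norm_normc (z : R[i]) : `|z| = real_complex R (normc z).
Proof. by case: z => a b; rewrite normc_def. Qed.

Lemma normc_opp (z : R[i]) : normc (- z) = normc z.
Proof. by case: z => a b; rewrite /= !sqrrN. Qed.

Lemma normc_triangle (x y : R[i]) : normc (x + y) <= normc x + normc y.
Proof. by have := ler_normD x y; rewrite !norm_normc -rmorphD lecR. Qed.

Lemma normc_sum (I : finType) (F : I -> R[i]) :
  normc (\sum_i F i) <= \sum_i normc (F i).
Proof.
elim/big_ind2 : _ => [|x y z t xy zt|//]; first by rewrite normc_real normr0.
by apply: le_trans (normc_triangle _ _) (lerD xy zt).
Qed.

(* A near-diagonal matrix with one dominant diagonal entry has at most one
   eigenvalue outside the disc containing the other entries: the difference
   [w] of two normalized eigenvectors would satisfy [|w| <= 12 n eta |w|]. *)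
Lemma dominant_eigenvalue_unique n (M : 'M[R]_n.+1) (d : 'I_n.+1 -> R)
    (eta lam : R) (u : 'rV[R]_n.+1) (z : R[i]) :
  12 * n.+1%:R * eta < 1 ->
  (forall k, k != ord0 -> `|d k| <= 2 / 3) ->
  (forall j k, `|M j k - d k *+ (j == k)| <= eta) ->
  u *m M = lam *: u -> u 0 ord0 = 1 -> (forall k, `|u 0 k| <= 1) ->
  5 / 6 <= normc z -> eigenvalue (map_mx (real_complex R) M) z ->
  z = real_complex R lam.
Proof.
move=> eta1 d23 Meta uM u0 u1 z56 /eigenvalueP[v vM v0].
pose U := map_mx (real_complex R) u; pose mu := v 0 ord0.
pose w := v - mu *: U; pose E : 'M[R]_n.+1 := \matrix_(j, k) (M j k - d k *+ (j == k)).
have UM : U *m map_mx (real_complex R) M = real_complex R lam *: U.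
  by rewrite -map_mxM uM map_mxZ.
have w0 : w 0 ord0 = 0 by rewrite !mxE u0 rmorph1 mulr1 subrr.
have wk k : (z - real_complex R (d k)) * w 0 k =
    \sum_j w 0 j * real_complex R (E j k)
    - (z - real_complex R lam) * mu * real_complex R (u 0 k).
  have : (w *m map_mx (real_complex R) M) 0 k =
      z * w 0 k + (z - real_complex R lam) * mu * real_complex R (u 0 k).
    by rewrite mulmxBl -scalemxAl UM vM !mxE; ring.
  have -> : (w *m map_mx (real_complex R) M) 0 k =
      \sum_j w 0 j * real_complex R (E j k) + real_complex R (d k) * w 0 k.
    rewrite mxE (bigD1 k) //= [in RHS](bigD1 k) //= !mxE eqxx mulr1n rmorphB /=.
    rewrite (eq_bigr (fun j => w 0 j * real_complex R (E j k))); last first.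
      by move=> j /negPf jk; rewrite !mxE jk mulr0n subr0.
    ring.
  by move=> /(canRL (addrK _)) ->; ring.
pose A := \sum_j normc (w 0 j).
have A0 : 0 <= A by apply: sumr_ge0 => j _; exact: normc_ge0.
have EA k : normc (\sum_j w 0 j * real_complex R (E j k)) <= eta * A.
  apply: le_trans (normc_sum _) _; rewrite mulr_sumr ler_sum // => j _.
  rewrite ComplexField.Normc.normcM normc_real mulrC ler_wpM2r ?normc_ge0 //.
  by rewrite mxE.
(* In component [ord0], [w] vanishes and [u] is 1, so the eigenvalue defect equals the error sum. *)
have zmu : normc ((z - real_complex R lam) * mu) <= eta * A.
  have := wk ord0; rewrite w0 mulr0 u0 rmorph1 mulr1 => /esym/eqP.
  by rewrite subr_eq0 => /eqP <-.
have wkA k : normc (w 0 k) <= 12 * (eta * A).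
  have [->|k0] := eqVneq k ord0.
    by rewrite w0 normc_real normr0; have := le_trans (normc_ge0 _) zmu; lra.
  have h : normc ((z - real_complex R (d k)) * w 0 k) <= 2 * (eta * A).
    rewrite wk; apply: le_trans (normc_triangle _ _) _.
    rewrite mulr_natl mulr2n lerD //.
    rewrite normc_opp ComplexField.Normc.normcM normc_real.
    apply: le_trans zmu; rewrite ler_piMr ?normc_ge0 //.
  (* The gap is [5 / 6 - 2 / 3]; with the factor 2 above it gives the constant 12. *)
  have zd : 6^-1 <= normc (z - real_complex R (d k)).
    have := normc_triangle (z - real_complex R (d k))
      (real_complex R (d k)).
    by rewrite subrK normc_real; have := d23 _ k0; lra.
  move: h; rewrite ComplexField.Normc.normcM; have := normc_ge0 (w 0 k); nra.
have AA : A <= n.+1%:R * (12 * (eta * A)).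
  apply: le_trans (ler_sum _ (fun k _ => wkA k)) _.
  by rewrite sumr_const card_ord [leRHS]mulr_natl lexx.
have {A0 AA} A0 : A = 0 by nra.
have wE : v = mu *: U.
  apply/eqP; rewrite -subr_eq0; apply/eqP/rowP => k; rewrite [RHS]mxE.
  apply/ComplexField.Normc.eq0_normc/le_anti.
  by rewrite normc_ge0 andbT; have := wkA k; rewrite A0 !mulr0.
have mu0 : mu != 0 by apply: contra_neq v0 => mu0; rewrite wE mu0 scale0r.
apply/eqP; rewrite -subr_eq0 -(mulIr_eq0 _ (mulIf mu0)); apply/eqP.
apply/ComplexField.Normc.eq0_normc/le_anti.
by rewrite normc_ge0 andbT; move: zmu; rewrite A0 mulr0.
Qed.

End DominantEigenvalue.

(** * Bifurcation theorem for abstract pitchfork systems *)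

Section Bifurcation.
Variables (R : realType) (n : nat).
Local Notation N := n.+2.

(** Entry [(j, k)] differentiates component [k] in variable [j], the convention of ['J] acting on
    row vectors. *)
Definition qjac (d : 'I_N -> R) q (a : 'rV[R]_N) : 'M[R]_N :=
  \matrix_(j, k) (d k *+ (j == k) + \sum_i (q k i j + q k j i) * a 0 i).

Lemma mul_qjac d q (a v : 'rV[R]_N) k :
  (v *m qjac d q a) 0 k = d k * v 0 k + lform q a k v.
Proof.
rewrite mxE; under eq_bigr do rewrite mxE mulrDr; rewrite big_split /=; congr (_ + _).
  rewrite (bigD1 k) //= eqxx mulr1n big1 ?addr0 1?mulrC // => j /negPf ->.
  by rewrite mulr0n mulr0.
rewrite /lform /qform -big_split /=.
rewrite -(pair_bigA _ (fun i j => q k i j * a 0 i * v 0 j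
                                  + q k i j * v 0 i * a 0 j)) /=.
under [RHS]eq_bigr do rewrite big_split; rewrite big_split /= exchange_big -big_split.
apply: eq_bigr => j _; rewrite mulr_sumr -big_split; apply: eq_bigr => i _ /=.
by ring.
Qed.

(** [124 = 31 * 4]: the eigenvalue error is [31 * remainder * x ^+ 4], and
    [x ^+ 2 <= 2 * e / m ^+ 2]. *)
Definition expansion_const (m : R) : R := 124 * remainder R n / m ^+ 4.

Theorem pitchfork_bifurcation (m e s c : R) d (q : 'I_N -> 'I_N -> 'I_N -> R) :
  0 < m -> 0 < e < branch_range n m -> pitchfork m e s c d q ->
  exists (a : 'rV[R]_N) (lam : R),
  [/\ forall k, a 0 k = d k * a 0 k + qform (q k) a a,
      0 < a 0 ord0 /\ `|e - s * c * a 0 ord0 ^+ 2| <= expansion_const m * e ^+ 2,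
      5 / 6 < lam < 1 /\ `|lam - (1 - 2 * e)| <= expansion_const m * e ^+ 2,
      eigenvalue (map_mx (real_complex R) (qjac d q a)) (real_complex R lam)
    & forall z, eigenvalue (map_mx (real_complex R) (qjac d q a)) z ->
        z != real_complex R lam -> ComplexField.Normc.normc z < 5 / 6].
Proof.
move=> m0 er pf; have S4 := size2_ge4 R n.
have [a [x [xr ax sa ex [xe Tx]]]] := pitchfork_branch m0 er pf.
case/andP: er => e0; rewrite /branch_range => eT.
have T1 := remainder_ge1 R n; have T0 := remainder_gt0 R n.
set T := remainder R n in T1 T0 eT Tx.
have m40 : 0 < m ^+ 4 by rewrite exprn_gt0.
have m41 : m ^+ 4 <= 1.
  by rewrite exprn_ile1 //; have := pf_s pf; lra.
have eT' : T * e / m ^+ 4 < 100^-1.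
  by rewrite ltr_pdivrMr //; move: eT; rewrite ltr_pdivlMr ?mulr_gt0 //; lra.
have e100 : e < 100^-1.
  by apply: lt_le_trans eT _; rewrite ler_pdivrMr ?mulr_gt0 //; lra.
case/andP: xr => x0 xr; have xr' : 0 <= x <= branch_radius R n by rewrite ltW.
have e24 : 0 < e < 24^-1 by apply/andP; split; lra.
have x4 : T * x ^+ 4 <= 4 * (T * e / m ^+ 4) * e.
  have -> : 4 * (T * e / m ^+ 4) * e = T * (2 * e / m ^+ 2) ^+ 2.
    by field; rewrite gt_eqF.
  have -> : x ^+ 4 = (x ^+ 2) ^+ 2 by rewrite -exprM.
  rewrite ler_pM2l // ler_pXn2r ?nnegrE ?sqr_ge0 //.
  by rewrite divr_ge0 ?sqr_ge0 // mulr_ge0 // ltW.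
have KE : expansion_const m * e ^+ 2 = 124 * (T * e / m ^+ 4) * e.
  by rewrite /expansion_const -/T; field; rewrite gt_eqF.
have [lam [v [ep lame v1]]] := eigenpair_exists pf x0 ax Tx e24.
have lamA := eigenpair_asymp pf x0 ax sa Tx (ltW m0) e24 ex xr' ep lame v1.
rewrite -/T in lamA.
have w0 : 0 < T * e / m ^+ 4 by rewrite divr_gt0 // mulr_gt0.
have lamK : `|lam - (1 - 2 * e)| <= expansion_const m * e ^+ 2.
  by apply: le_trans lamA _; rewrite KE -mulrA; nra.
have vJ : v *m qjac d q a = lam *: v.
  by apply/rowP => k; rewrite mul_qjac mxE ep.2.
exists a, lam; split.
- move=> k; have [->|k0] := eqVneq k ord0; last exact: sa.2.
  rewrite sa.1 (pf_d0 pf) mulrDl mul1r -addrA ex addr0 //.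
- rewrite sa.1; split => //; apply: le_trans (small_e pf x0 ax sa ex xr') _.
  by rewrite -/T KE; nra.
(* The error is below [1.24 * e], hence cannot undo the decrease [2 * e]. *)
- split=> //; have : expansion_const m * e ^+ 2 < 2 * e by rewrite KE; nra.
  by move: lamK; rewrite ler_norml; lra.
- apply/eigenvalueP; exists (map_mx (real_complex R) v).
    by rewrite -map_mxM vJ map_mxZ.
  apply/eqP => /rowP/(_ ord0); rewrite !mxE ep.1 rmorph1 => /eqP.
  by rewrite oner_eq0.
- move=> z ez; apply: contraNlt => z56; apply/eqP.
  (* Each perturbation entry is a sum of [N] terms of size at most [4 * x]; [small_x] then makes
     [12 * N * eta] at most 1/8. *)
  apply: (@dominant_eigenvalue_unique R n.+1 (qjac d q a) d
    (N%:R * (4 * x)) lam v z) ez => //; first 1 last.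
  + exact: pf_d pf.
  + move=> j k; rewrite mxE addrAC subrr add0r.
    have -> : N%:R = #|'I_N|%:R :> R by rewrite card_ord.
    apply: ler_norm_sum_const => i; rewrite normrM ler_pM //.
      apply: le_trans (ler_normD _ _) _.
      by have := lerD (pf_q pf k i j) (pf_q pf k j i); lra.
    exact: le_trans (rV_coord_le _ _) ax.
  + exact: ep.1.
  + have := small_x x0 Tx.
    rewrite (_ : 12 * N%:R * (N%:R * (4 * x)) = 8^-1 * (384 * size2 R n * x)).
      lra.
    by rewrite /size2; field.
Qed.

End Bifurcation.

(** * Values and bounds of the sinc function at half-integers *)

Section SincValues.
Variable R : realType.
Local Notation Gam := (@Gam R).

Lemma sin_natpi k : sin (pi * k%:R : R) = 0.
Proof.
elim: k => [|k IH]; first by rewrite mulr0 sin0.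
by rewrite -natr1 mulrDr mulr1 sinDpi IH oppr0.
Qed.

Lemma Gam_nat k : (0 < k)%N -> Gam k%:R = 0.
Proof. by move=> k0; rewrite /Defs.Gam pnatr_eq0 gtn_eqF // sin_natpi mul0r. Qed.

Lemma Gam_half : Gam (1 / 2) = 2 / pi.
Proof.
have pi0 := pi_gt0 R; rewrite /Defs.Gam mul1r invr_eq0 pnatr_eq0 /= sin_pihalf.
by field; lra.
Qed.

Lemma Gam_three_halves : Gam (3 / 2) = - (2 / (3 * pi)).
Proof.
have pi0 := pi_gt0 R; rewrite /Defs.Gam mulf_eq0 invr_eq0 !pnatr_eq0 /=.
have -> : pi * (3 / 2) = pi / 2 + pi :> R by field.
by rewrite sinDpi sin_pihalf; field; lra.
Qed.

Lemma Gam_le (u b : R) : 0 < b -> b <= `|u| -> `|Gam u| <= (2 * b)^-1.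
Proof.
move=> b0 bu; have u0 : u != 0 by rewrite -normr_gt0; lra.
have pi2 := pi_ge2 R.
rewrite /Defs.Gam (negPf u0) normrM normfV normrM (ger0_norm (pi_ge0 R)).
have -> : (2 * b)^-1 = 1 * (2 * b)^-1 by rewrite mul1r.
apply: ler_pM; rewrite ?invr_ge0 ?mulr_ge0 ?pi_ge0 //.
- by rewrite ler_norml sin_geN1 sin_le1.
- rewrite lef_pV2 ?posrE; [|nra|lra].
  by nra.
Qed.

(** A nonzero half-integer has modulus at least 1/2, where [Gam_le] gives 1. *)
Lemma Gam_half_le1 (i k : nat) : `|Gam (i%:R - k%:R / 2)| <= 1.
Proof.
have [ik|ik] := eqVneq (i + i)%N k.
  rewrite -ik natrD (_ : _ - _ = 0); last by field.
  by rewrite /Defs.Gam eqxx normr1.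
rewrite [leRHS](_ : 1 = (2 * 2^-1)^-1); last by field.
apply: Gam_le; first by rewrite invr_gt0.
have -> : i%:R - k%:R / 2 = ((i + i)%N%:R - k%:R) / 2 :> R by rewrite natrD; field.
rewrite normrM (@ger0_norm _ 2^-1) ?invr_ge0 // ler_peMl ?invr_ge0 //.
have [lt|ge] := ltnP (i + i) k.
  rewrite distrC -natrB 1?ltnW // ger0_norm // ler1n subn_gt0 //.
rewrite -natrB // ger0_norm // ler1n subn_gt0 ltn_neqAle ge andbT eq_sym //.
Qed.

(** Zero at [k = 2], and [Gam_le] with [b = 3 / 2] beyond. This is the source of the damping bound
    2/3. *)
Lemma Gam_tail_le (k : nat) : (1 < k)%N -> `|Gam (k%:R / 2)| <= 3^-1.
Proof.
rewrite leq_eqVlt => /predU1P[<-|k3].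
  by rewrite divff // (@Gam_nat 1) // normr0 invr_ge0.
have -> : 3^-1 = (2 * (3 / 2))^-1 :> R by congr _^-1; field.
apply: Gam_le; first by rewrite divr_gt0.
rewrite ger0_norm ?divr_ge0 // ler_pM2r ?invr_gt0 // ler_nat //.
Qed.

End SincValues.

(** * The Fourier system as a quadratic system, and its Jacobian *)

Section StationaryEquations.
Variables (R : realType) (n : nat) (c : nat -> R).
Local Notation N := n.+2.

Definition diag_coef (k : 'I_N) : R := 2 * c k.+1 * Gam (k.+1%:R / 2).

(** Merges both sums of the equation: [i + j = k] encodes the products [a_n a_(k-n)] and [i = k + j]
    the products [a_n a_(n-k)], where index [i] stands for mode [i + 1]. *)
Definition quad_coef (k i j : 'I_N) : R :=
  c k.+1 * Gam (i.+1%:R - k.+1%:R / 2)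
  * ((i.+1 + j.+1 == k.+1)%N%:R + 2 * (i.+1 == k.+1 + j.+1)%N%:R).

Lemma coef_of_ord (v : 'rV[R]_N) (i : 'I_N) : coef_of v i.+1 = v 0 i.
Proof. by rewrite /coef_of /= valK. Qed.

Lemma coef_of_gt (v : 'rV[R]_N) k : (N < k)%N -> coef_of v k = 0.
Proof. by case: k => // k kN; rewrite /coef_of insubF //; lia. Qed.

Lemma trunc_coef_of (v : 'rV[R]_N) : trunc_vec N (coef_of v) = v.
Proof. by apply/rowP => i; rewrite mxE coef_of_ord. Qed.

Lemma coef_of_sum (v : 'rV[R]_N) k : (0 < k)%N ->
  \sum_(j < N) (j.+1 == k)%:R * v 0 j = coef_of v k.
Proof.
move=> k0; have [kN|kN] := ltnP N k.
  rewrite coef_of_gt // big1 // => j _; rewrite (_ : _ == _ = false) ?mul0r //.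
  by have := ltn_ord j; lia.
have kN' : (k.-1 < N)%N by lia.
rewrite (bigD1 (Ordinal kN')) //= prednK // eqxx mul1r big1 ?addr0.
  by rewrite -coef_of_ord; congr coef_of; rewrite prednK.
move=> j /eqP jk; rewrite (_ : _ == _ = false) ?mul0r //.
by apply/eqP => jk'; apply: jk; apply: val_inj; rewrite /= -jk'.
Qed.

(** Both sums are widened to all modes, their ranges becoming tests; for fixed [i] the sum over [j]
    then collapses by [coef_of_sum]. *)
Lemma QmapE (v : 'rV[R]_N) k :
  Qmap c v 0 k = diag_coef k * v 0 k + qform (quad_coef k) v v.
Proof.
rewrite mxE; cbv beta zeta; rewrite coef_of_ord -addrA; congr (_ + _).
rewrite (@big_nat_widen _ _ _ 1 k.+1 N.+1) //; last by have := ltn_ord k; lia.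
rewrite (@big_nat_widenl _ _ _ k.+2 1 N.+1) //.
rewrite !big_add1 !big_mkord [in X in _ * X + _]big_mkcond.
rewrite [in X in _ + _ * X]big_mkcond !mulr_sumr -big_split.
rewrite /qform -(pair_bigA _ (fun i j => quad_coef k i j * v 0 i * v 0 j)).
apply: eq_bigr => i _; rewrite !andTb !(coef_of_ord v i) /quad_coef.
rewrite (eq_bigr (fun j : 'I_N =>
   c k.+1 * Gam (i.+1%:R - k.+1%:R / 2) * v 0 i
     * ((i.+1 + j.+1 == k.+1)%N%:R * v 0 j)
   + 2 * c k.+1 * Gam (i.+1%:R - k.+1%:R / 2) * v 0 i
     * ((i.+1 == k.+1 + j.+1)%N%:R * v 0 j))); last by move=> j _; ring.
rewrite big_split -!mulr_sumr; congr (_ + _).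
  case: ltnP => ik.
    rewrite -coef_of_sum ?subn_gt0 // !mulrA; congr (_ * _).
    by apply: eq_bigr => j _; congr (_%:R * _); lia.
  rewrite big1 ?mulr0 // => j _; rewrite (_ : _ == _ = false) ?mul0r //; lia.
case: ltnP => ik.
  rewrite -coef_of_sum ?subn_gt0 // !mulrA; congr (_ * _).
  by apply: eq_bigr => j _; congr (_%:R * _); lia.
rewrite big1 ?mulr0 // => j _; rewrite (_ : _ == _ = false) ?mul0r //; lia.
Qed.

Lemma mulmxr_continuous p (M : 'M[R]_p) : continuous (fun v : 'rV[R]_p => v *m M).
Proof.
apply: (@linear_continuous R _ _ (mulmxr M)); apply/eqO_exP.
pose B := 1 + \sum_i \sum_j `|M i j|.
have S0 i : 0 <= \sum_j `|M i j| by apply: sumr_ge0.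
have B0 : 0 < B by rewrite ltr_pwDl // sumr_ge0.
exists B => //; near=> v; rewrite /= normr1 mulr1.
have v1 : `|v| <= 1.
  near: v; apply/nbhs_ballP; exists 1 => //= v.
  by rewrite -ball_normE /= sub0r normrN => /ltW.
apply: rV_norm_le => [|k]; first exact: ltW.
rewrite mxE; apply: le_trans (ler_norm_sum _ _ _) _.
apply: (@le_trans _ _ (\sum_i \sum_j `|M i j|)); last by rewrite lerDr.
apply: ler_sum => i _; rewrite normrM.
apply: (@le_trans _ _ `|M i k|).
  by rewrite ler_piMl // (le_trans (rV_coord_le _ _)).
by rewrite (bigD1 k) //= lerDl sumr_ge0.
Unshelve. all: by end_near. Qed.

(** The Taylor remainder is exactly the quadratic part at [h], which is [o(h)]; uniqueness of the
    differential concludes. *)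
Lemma jacobian_Qmap (a : 'rV[R]_N) :
  'J (@Qmap R N c) a = qjac diag_coef quad_coef a.
Proof.
set M := qjac _ _ _.
have dQ : 'd (@Qmap R N c) a = mulmxr M :> ('rV[R]_N -> 'rV[R]_N).
  apply: diff_unique; first exact: mulmxr_continuous.
  apply/eqaddoP => eps eps0.
  pose F (t : 'I_N * 'I_N * 'I_N) := `|quad_coef t.1.1 t.1.2 t.2|.
  pose B := 1 + \sum_t F t.
  have F0 t : 0 <= F t by exact: normr_ge0.
  have B0 : 0 < B by rewrite ltr_pwDl // sumr_ge0.
  have qB k i j : `|quad_coef k i j| <= B.
    rewrite /B (bigD1 (k, i, j)) //= addrCA lerDl.
    by apply: addr_ge0 => //; apply: sumr_ge0 => t _; exact: F0.
  pose D := N%:R ^+ 2 * B.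
  have D0 : 0 < D by rewrite mulr_gt0 // exprn_gt0 // ltr0n.
  apply/nbhs_ballP; exists (eps / D); first exact: divr_gt0.
  move=> h; rewrite -ball_normE /= sub0r normrN => /ltW hD.
  have -> : ((@Qmap R N c \o shift a) - (cst (Qmap c a) + mulmxr M)) h
      = \row_k qform (quad_coef k) h h.
    apply/rowP => k; rewrite !fctE /= /shift /cst.
    rewrite [LHS]mxE [X in _ + X]mxE [X in - X]mxE.
    rewrite !QmapE mul_qjac /lform qformDl !qformDr !mxE.
    by ring.
  apply: rV_norm_le => [|k]; first by rewrite mulr_ge0 // ltW.
  rewrite mxE; apply: le_trans (qform_le_norm _ _ (qB k)) _.
  by rewrite !mulrA ler_wpM2r // -/D mulrC -ler_pdivlMr.
apply/row_matrixP => i; rewrite !rowE /jacobian.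
by rewrite mul_rV_lin1 dQ.
Qed.

End StationaryEquations.

(** * The noise system is a pitchfork *)

Section NoiseSystem.
Variables (R : realType) (n : nat).
Local Notation N := n.+2.

(** The partial sums of the tail are eventually constant, so the series reduces to the finite sum in
    [Qmap]. Beyond mode [N] all terms vanish. *)
Lemma stationary_coef_of (c : nat -> R) (v : 'rV[R]_N) :
  (forall k, (N < k)%N -> c k = 0) ->
  (forall k, v 0 k = diag_coef c k * v 0 k + qform (quad_coef c k) v v) ->
  stationary c (coef_of v).
Proof.
move=> cN vE; split=> // k k1.
have near_sum : \forall p \near \oo,
    \sum_(k.+1 <= i < p) tail_term (coef_of v) k i =
    \sum_(k.+1 <= i < N.+1) tail_term (coef_of v) k i.
  near=> p; have Np : (N.+1 <= p)%N by near: p; exact: nbhs_infty_ge.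
  have tail0 i : (N < i)%N -> tail_term (coef_of v) k i = 0.
    by move=> Ni; rewrite /tail_term coef_of_gt // mulr0 mul0r.
  have [kN|Nk] := leqP k.+1 N.+1.
    rewrite (@big_cat_nat _ _ _ N.+1 k.+1 p) //= [X in _ + X]big_nat_cond.
    by rewrite [X in _ + X]big1 ?addr0 // => i; rewrite andbT => /andP[/tail0].
  rewrite [RHS]big_geq 1?ltnW // big_nat_cond big1 // => i.
  by rewrite andbT => /andP[ki _]; apply: tail0; lia.
split; first exact: is_cvg_near_cst near_sum.
rewrite /boltzmann_rhs.
have -> : limn (fun p => \sum_(k.+1 <= i < p) tail_term (coef_of v) k i) =
    \sum_(k.+1 <= i < N.+1) tail_term (coef_of v) k i.
  exact: (@lim_near_cst _ (@Rhausdorff R)) near_sum.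
have [kN|Nk] := leqP k N; last first.
  by rewrite cN // coef_of_gt // !(mulr0, mul0r) oppr0 !addr0.
have k1N : (k.-1 < N)%N by lia.
have := QmapE c v (Ordinal k1N); rewrite -vE mxE; cbv beta zeta.
have -> : (Ordinal k1N).+1 = k by rewrite /= prednK.
rewrite -(coef_of_ord v (Ordinal k1N)).
have -> : (Ordinal k1N).+1 = k by rewrite /= prednK.
move/eqP; rewrite -subr_eq0 => /eqP h; rewrite -[RHS]h /tail_term.
by ring.
Unshelve. all: by end_near. Qed.

(** Here [e] is the linear rate [2 * c 1 * Gam (1 / 2) - 1] and [s] is [- 2 * c 1 * Gam (3 / 2)].
    The latter is 1/3 at [c 1 = pi / 4] and increases with [c 1], whence [m <= 3^-1]. *)
Lemma noise_pitchfork (c : nat -> R) (m eps : R) :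
  (forall k, (1 < k)%N -> `|c k| <= 1) -> c 1%N = pi / 4 + eps ->
  0 <= eps -> pi / 4 + eps <= 1 -> m <= 3^-1 -> m <= c 2%N ->
  pitchfork m (4 * eps / pi) (4 * c 1%N / (3 * pi)) (c 2%N)
    (@diag_coef R n c) (@quad_coef R n c).
Proof.
move=> cb c1E eps0 eps1 m3 mc; have pi2 := pi_ge2 R.
have c1b k : (0 < k)%N -> `|c k| <= 1.
  rewrite leq_eqVlt => /predU1P[<-|]; last exact: cb.
  by rewrite c1E ger0_norm; lra.
have pi0 : pi != 0 :> R by rewrite gt_eqF // pi_gt0.
split.
- apply/andP; split.
    apply: le_trans m3 _; rewrite c1E ler_pdivlMr; lra.
  by rewrite c1E ler_pdivrMr; lra.
- by rewrite mc; have := cb 2%N isT; rewrite ler_norml => /andP[].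
- by rewrite /diag_coef /= Gam_half c1E; move: pi0; generalize (@pi R) => P P0; field.
- by rewrite /diag_coef /= divff // (@Gam_nat R 1) // mulr0.
- move=> k k0; rewrite /diag_coef !normrM (@ger0_norm _ 2) // -mulrA ler_pM2l //.
  rewrite -[leRHS]mul1r; apply: ler_pM => //; first exact: c1b.
  by apply: Gam_tail_le; case: k k0 => -[].
- move=> k i j; rewrite /quad_coef normrM -[leRHS]mul1r; apply: ler_pM => //.
    rewrite normrM -[leRHS]mul1r; apply: ler_pM => //; first exact: c1b.
    exact: Gam_half_le1.
  case: (eqVneq (i.+1 + j.+1)%N k.+1) => ijk.
    by rewrite (_ : _ == _ = false) /= ?mulr0 ?addr0 ?normr1 ?ler1n //; lia.
  by case: eqVneq => _ /=; rewrite ?mulr0 ?mulr1 ?add0r ?normr0 ?ger0_norm.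
- rewrite /quad_coef /=.
  rewrite (_ : 2 - 1 / 2 = 3 / 2); last by field.
  by rewrite Gam_three_halves; move: pi0; generalize (@pi R) => P P0; field.
(* In the first equation only products of consecutive modes occur. *)
- move=> i j ij; have [ij1|ij1] := eqVneq (i : nat) j.+1; last first.
    left; rewrite /quad_coef /= (_ : (_ + _ == _)%N = false); last by lia.
    by rewrite (_ : _ == _ = false) ?mulr0 ?addr0 ?mulr0 //= add1n eqSS; apply/negbTE.
  right; have j0 : j != ord0.
    apply: contraNneq ij => j0; rewrite xpair_eqE j0 eqxx andbT.
    by apply/eqP/val_inj; rewrite /= ij1 j0.
  by split => //; rewrite ij1 ltnS lt0n; move: j0; rewrite -val_eqE.
- rewrite /quad_coef /= divff // subrr /Gam eqxx mulr0 addr0 !mulr1 //.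
(* Besides [a_1^2], the second equation only has terms with [Gam] at a positive integer, which is
   0. *)
- move=> i j ij; rewrite /quad_coef (_ : (snd_index n).+1 = 2%N) //.
  rewrite (_ : (_ + _ == _)%N = false); last first.
    apply: contraNF ij => /eqP ij; rewrite xpair_eqE -!val_eqE /=.
    by apply/andP; split; apply/eqP; lia.
  case: eqVneq => [i3|_]; last by rewrite mulr0 addr0 mulr0.
  by rewrite divff // -natr1 addrK Gam_nat ?mulr0 ?mul0r //; lia.
- move=> k k1; rewrite /quad_coef /= (_ : (_ == _) = false); last by lia.
  by rewrite (_ : (_ == _) = false) ?mulr0 ?addr0 ?mulr0 //; lia.
Qed.

End NoiseSystem.

(** Applied to [gamma_2] at [pi / 4]: replacing [gamma_2(gamma_1)] by its value there costs only
    [O(gamma_1 - pi / 4)]. *)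
Lemma deriv_on_lipschitz (R : realType) (f f' : R -> R) (a b p : R) :
  a <= p < b -> deriv_on a b f f' ->
  exists L delta : R, [/\ 0 < L, 0 < delta
    & forall h, 0 < h < delta -> `|f (p + h) - f p| <= L * h].
Proof.
move=> /andP[ap pb] /(_ p); rewrite ap ltW // => /(_ isT) /cvgrPdist_le /=.
move=> /(_ 1 ltr01); rewrite near_withinE => -[d /= d0 hd].
exists (1 + `|f' p|), (Num.min d (b - p)); split.
- by rewrite ltr_pwDl.
- by rewrite lt_min d0 subr_gt0.
move=> h /andP[h0]; rewrite lt_min => /andP[h_d hb].
have := hd h; rewrite /ball_ /= sub0r normrN gtr0_norm // => /(_ h_d).
rewrite gt_eqF // => /(_ isT) /(_ _) H.
have {}H : `|f' p - h^-1 * (f (p + h) - f p)| <= 1.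
  by apply: H; apply/andP; split; lra.
rewrite -ler_pdivrMr // -[X in _ / X](gtr0_norm h0) -normfV -normrM mulrC.
have := ler_normB (f' p) (f' p - h^-1 * (f (p + h) - f p)).
by rewrite opprB addrC subrK; lra.
Qed.

(** * Stability of the uniform distribution *)

Section UniformDistribution.
Variable R : realType.
Local Notation uniform_coef := (@uniform_coef R).

Lemma uniform_coefE n : uniform_coef = coef_of (0 : 'rV[R]_n).
Proof.
apply/funext => -[|k]; rewrite /Defs.uniform_coef //=.
by case: insubP => // i _ _; rewrite mxE.
Qed.

Lemma uniform_stationary n (c : nat -> R) :
  (forall k, (n.+2 < k)%N -> c k = 0) -> stationary c uniform_coef.
Proof.
move=> cN; rewrite (uniform_coefE n.+2); apply: stationary_coef_of => // k.
by rewrite -[X in qform _ X _](scale0r 0) qformZl !mxE mulr0 mul0r addr0.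
Qed.

Lemma uniform_rate1 (c : nat -> R) : uniform_rate c 1 = 4 * c 1%N / pi - 1.
Proof.
have pi0 := pi_gt0 R; rewrite /uniform_rate Gam_half.
by move: pi0; generalize (@pi R) => P P0; field; rewrite gt_eqF.
Qed.

(** As [2 / 3 < 1], only the first mode can destabilize. *)
Lemma uniform_rate_le0 (c : nat -> R) k :
  (1 < k)%N -> `|c k| <= 1 -> uniform_rate c k <= 0.
Proof.
move=> k1 ck; rewrite subr_le0 -mulrA.
have := ler_pM (normr_ge0 _) (normr_ge0 _) ck (Gam_tail_le R k1).
by rewrite -normrM ler_norml; lra.
Qed.

End UniformDistribution.

(** * Amplitude asymptotics and conclusion *)

Lemma pi_lt4 (R : realType) : pi < 4 :> R.
Proof. by have := @pihalf_lt2 R; lra. Qed.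

(** The announced amplitude [y] solves the truncated equation up to [eps ^+ 2], so [x ^+ 2 - y ^+ 2]
    is of that order; dividing by [x + y >= Num.sqrt eps] leaves the power 3/2. *)
Lemma amplitude_expansion (R : realType) (eps e s c kap x m K L : R) :
  0 < eps -> 0 < m -> 0 < kap <= 1 -> 0 < c <= 1 -> 0 < K -> 0 < L ->
  e = 4 * eps / pi -> s = 4 * (pi / 4 + eps) / (3 * pi) ->
  m <= s -> m <= c -> 0 < x ->
  `|e - s * c * x ^+ 2| <= K * e ^+ 2 -> `|c - kap| <= L * eps ->
  `|x - Num.sqrt (12 * eps / (pi * kap))| <=
    (4 * K + 2 * (L + 2) / kap) / m ^+ 2 * (eps * Num.sqrt eps).
Proof.
move=> eps0 m0 /andP[kap0 kap1] /andP[c0 c1] K0 L0 eE sE ms mc x0 ex ck.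
have pi2 := pi_ge2 R; have pi4 := pi_lt4 R.
have e0 : 0 < e by rewrite eE divr_gt0 ?mulr_gt0 //; lra.
have e2 : e <= 2 * eps by rewrite eE ler_pdivrMr; nra.
set y := Num.sqrt _.
have w0 : 0 < 12 * eps / (pi * kap) by rewrite divr_gt0 ?mulr_gt0 //; lra.
have y2 : y ^+ 2 = 12 * eps / (pi * kap) by rewrite sqr_sqrtr // ltW.
have yeps : Num.sqrt eps <= y.
  rewrite ler_wsqrtr // ler_pdivlMr ?mulr_gt0 //; last lra.
  by have : pi * kap <= 4 * 1 by [apply: ler_pM; lra]; nra.
have r0 : 0 < Num.sqrt eps by rewrite sqrtr_gt0.
have r2 : Num.sqrt eps ^+ 2 = eps by rewrite sqr_sqrtr // ltW.
set r := Num.sqrt eps in yeps r0 r2 *.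
(* The factor [1 + e] appears because [s = (1 + e) / 3]. *)
have yE : s * c * y ^+ 2 = e * (1 + e) * (c / kap).
  rewrite y2 eE sE; have : pi != 0 :> R by lra.
  by generalize (@pi R) => P P0; field; rewrite P0 gt_eqF.
have ey : `|e - s * c * y ^+ 2| <= 2 * (L + 2) / kap * eps ^+ 2.
  have -> : e - s * c * y ^+ 2 = e * ((kap - c - e * c) / kap).
    by rewrite yE; field; rewrite gt_eqF.
  rewrite !normrM normfV (gtr0_norm e0) (gtr0_norm kap0).
  have h : `|kap - c - e * c| <= (L + 2) * eps.
    apply: le_trans (ler_normB _ _) _; rewrite distrC mulrDl lerD //.
    by rewrite gtr0_norm ?mulr_gt0 //; nra.
  have -> : 2 * (L + 2) / kap * eps ^+ 2 = 2 * eps * ((L + 2) * eps / kap).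
    by field; rewrite gt_eqF.
  by apply: ler_pM; rewrite ?mulr_ge0 ?invr_ge0 ?ler_pM2r ?invr_gt0 //; lra.
have Ke : K * e ^+ 2 <= 4 * K * eps ^+ 2.
  have -> : 4 * K * eps ^+ 2 = K * (2 * eps) ^+ 2 by ring.
  by rewrite ler_pM2l // ler_pXn2r ?nnegrE //; lra.
set D := 4 * K + 2 * (L + 2) / kap.
have D0 : 0 < D by rewrite addr_gt0 ?divr_gt0 ?mulr_gt0 //; lra.
have xy : m ^+ 2 * `|x ^+ 2 - y ^+ 2| <= D * eps ^+ 2.
  apply: (@le_trans _ _ (s * c * `|x ^+ 2 - y ^+ 2|)).
    by rewrite ler_wpM2r // expr2 ler_pM //; lra.
  have -> : s * c * `|x ^+ 2 - y ^+ 2| =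
      `|(e - s * c * y ^+ 2) - (e - s * c * x ^+ 2)|.
    rewrite -[s * c in LHS]gtr0_norm ?mulr_gt0 //; last lra.
    by rewrite -normrM; congr `|_|; ring.
  apply: le_trans (ler_normB _ _) _; rewrite /D mulrDl addrC.
  by apply: lerD ey; exact: le_trans ex Ke.
have xyr : `|x - y| * r <= `|x ^+ 2 - y ^+ 2|.
  by rewrite subr_sqr normrM ler_wpM2l // gtr0_norm; lra.
rewrite mulrAC ler_pdivlMr ?exprn_gt0 // -(ler_pM2r r0).
have -> : D * (eps * r) * r = D * eps ^+ 2.
  by rewrite -mulrA -(mulrA eps) -[r * r]expr2 r2 -expr2.
apply: le_trans xy; rewrite mulrAC mulrC ler_pM2l ?exprn_gt0 //.
Qed.

Lemma powR_three_halves (R : realType) (x : R) :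
  0 < x -> x `^ (3 / 2) = x * Num.sqrt x.
Proof.
move=> x0; rewrite (_ : 3 / 2 = 1 + 2^-1); last by field.
by rewrite powRD ?gt_eqF ?implybT // powRr1 ?ltW // powR12_sqrt ?ltW.
Qed.

Lemma noise_coef_le1 (R : realType) N (gam : nat -> R -> R) g1 k :
  (forall l, (2 <= l <= N)%N -> -1 <= gam l g1 <= 1) -> (1 < k)%N ->
  `|noise_coef N gam g1 k| <= 1.
Proof.
move=> gb; rewrite /noise_coef; case: k => [//|[//|k]] k1 /=.
case: ifP => kN; last by rewrite normr0.
by rewrite ler_norml gb.
Qed.

Theorem theorem10 (R : realType) (N : nat) (hN : (2 <= N)%N)
  (gam : nat -> R -> R) (g : R -> R -> R)
  (hg : forall g1 x : R, 0 <= g1 <= 1 -> - pi < x <= pi ->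
     g g1 x = 1 + 2 * g1 * cos x
              + 2 * \sum_(2 <= k < N.+1) gam k g1 * cos (k%:R * x))
  (hC2 : forall k : nat, (2 <= k <= N)%N -> C2_on 0 1 (gam k))
  (hbnd : forall (k : nat) (g1 : R), (2 <= k <= N)%N -> 0 <= g1 <= 1 ->
     -1 <= gam k g1 <= 1)
  (hpos : forall g1 : R, 0 <= g1 <= 1 -> 0 < gam 2%N g1) :
  [/\ (forall g1 : R, 0 <= g1 <= 1 ->
         [/\ stationary (noise_coef N gam g1) (@uniform_coef R),
             (g1 < pi / 4 -> uniform_stable (noise_coef N gam g1))
           & (pi / 4 < g1 -> uniform_unstable (noise_coef N gam g1))])
    & exists gmax : R, pi / 4 < gmax <= 1 /\
      exists (a : R -> nat -> R) (lam : R -> R),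
        [/\ (forall g1 : R, pi / 4 < g1 < gmax ->
               [/\ stationary (noise_coef N gam g1) (a g1),
                   a g1 <> @uniform_coef R,
                   (forall k : nat, (N < k)%N -> a g1 k = 0),
                   linearly_stable N (noise_coef N gam g1) (a g1)
                 & leading_eigenvalue
                     (jacobianQ N (noise_coef N gam g1) (a g1))
                     (real_complex R (lam g1))]),
            (fun g1 : R => a g1 1%N
               - Num.sqrt (12 * (g1 - pi / 4) / (pi * gam 2%N (pi / 4))))
              =O_ ((pi / 4 : R)^'+) (fun g1 : R => (g1 - pi / 4) `^ (3 / 2))
          & (fun g1 : R => lam g1 - (1 - 8 / pi * (g1 - pi / 4)))
              =O_ ((pi / 4 : R)^'+) (fun g1 : R => (g1 - pi / 4) `^ (3 / 2))]].
Proof.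
case: N hN hg hC2 hbnd => [|[|n]] // _ _ hC2 hbnd.
have cN g1 k : (n.+2 < k)%N -> noise_coef n.+2 gam g1 k = 0.
  by case: k => [|[|k]] // kN; rewrite /noise_coef /= leqNgt kN.
have cb g1 k : 0 <= g1 <= 1 -> (1 < k)%N -> `|noise_coef n.+2 gam g1 k| <= 1.
  by move=> g01; apply: noise_coef_le1 => l lN; exact: hbnd.
have c1E g1 : noise_coef n.+2 gam g1 1 = g1 by [].
have [pi2 pi4] := (pi_ge2 R, pi_lt4 R).
split.
  move=> g1 g01; split.
  - exact: uniform_stationary (cN g1).
  - move=> g1pi k; rewrite leq_eqVlt => /predU1P[<-|k1].
      by rewrite uniform_rate1 c1E subr_le0 ler_pdivrMr; lra.
    by apply: uniform_rate_le0 => //; exact: cb.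
  - move=> g1pi /(_ 1%N isT); rewrite uniform_rate1 c1E subr_le0 ler_pdivrMr; lra.
set kap := gam 2%N (pi / 4).
have kap01 : 0 < kap <= 1.
  have g4 : 0 <= (pi : R) / 4 <= 1 by apply/andP; split; lra.
  by rewrite hpos //=; case/andP: (hbnd 2%N (pi / 4) isT g4).
have [f' [f'' [df _ _]]] := hC2 2%N isT.
have [|L [dl [L0 dl0 hL]]] := deriv_on_lipschitz (p := pi / 4) _ df.
  by apply/andP; split; lra.
(* A common lower bound for [s >= 1 / 3] and for [gamma_2], which stays above [kap / 2] near
   [pi / 4]. *)
pose m := Num.min (kap / 2) (3^-1 : R).
have kap0 : 0 < kap by case/andP: kap01.
have m0 : 0 < m by rewrite lt_min divr_gt0 //= invr_gt0.
have br0 := @branch_range_gt0 R n m m0.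
(* In order: validity of the Lipschitz bound, [gamma_2 >= kap / 2], the branch range (as
   [e <= 2 * eps]), and [gamma_1 <= 1]. *)
pose eps0 := Num.min (Num.min dl (kap / (2 * L)))
                     (Num.min (branch_range n m / 2) (1 - pi / 4)).
have eps00 : 0 < eps0.
  by rewrite !lt_min dl0 !divr_gt0 ?mulr_gt0 //=; lra.
pose K := expansion_const n m.
have K0 : 0 < K by rewrite divr_gt0 ?mulr_gt0 ?exprn_gt0 ?remainder_gt0.
pose C := Num.max ((4 * K + 2 * (L + 2) / kap) / m ^+ 2) (4 * K).
(* The range condition is a premise, so that [choice] yields functions on all of [R]; outside the
   range a dummy pair serves. *)
pose good g1 (p : (nat -> R) * R) := pi / 4 < g1 < pi / 4 + eps0 ->
  [/\ [/\ stationary (noise_coef n.+2 gam g1) p.1,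
         p.1 <> @uniform_coef R,
         (forall k : nat, (n.+2 < k)%N -> p.1 k = 0),
         linearly_stable n.+2 (noise_coef n.+2 gam g1) p.1
       & leading_eigenvalue (jacobianQ n.+2 (noise_coef n.+2 gam g1) p.1)
           (real_complex R p.2)],
     `|p.1 1%N - Num.sqrt (12 * (g1 - pi / 4) / (pi * kap))| <=
        C * ((g1 - pi / 4) * Num.sqrt (g1 - pi / 4))
   & `|p.2 - (1 - 8 / pi * (g1 - pi / 4))| <=
        C * ((g1 - pi / 4) * Num.sqrt (g1 - pi / 4))].
have ex_good g1 : exists p, good g1 p.
  have [g1r|] := boolP (pi / 4 < g1 < pi / 4 + eps0); last first.
    by move=> /negP nr; exists (fun=> 0, 0) => g1r; case: nr.
  case/andP: (g1r) => gl gu; pose eps := g1 - pi / 4.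
  have epsE : g1 = pi / 4 + eps by rewrite addrC subrK.
  have eps_gt0 : 0 < eps by rewrite subr_gt0.
  have : eps < eps0 by rewrite ltrBlDl.
  rewrite !lt_min => /andP[/andP[edl ekap] /andP[ebr e1]].
  have g01 : 0 <= g1 <= 1 by apply/andP; split; lra.
  set c := noise_coef n.+2 gam g1.
  have c2E : c 2%N = gam 2%N g1 by [].
  have ck : `|c 2%N - kap| <= L * eps.
    by rewrite c2E epsE; apply: hL; rewrite eps_gt0.
  have mc : m <= c 2%N.
    rewrite ge_min; apply/orP; left.
    move: ekap; rewrite ltr_pdivlMr ?mulr_gt0 //.
    by move: ck; rewrite ler_norml; lra.
  have pf : pitchfork m (4 * eps / pi) (4 * c 1%N / (3 * pi)) (c 2%N)
      (@diag_coef R n c) (@quad_coef R n c).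
    apply: noise_pitchfork => //; try lra.
    - by move=> k; exact: cb.
    - by rewrite ge_min lexx orbT.
  set e := 4 * eps / pi in pf.
  have e0 : 0 < e by rewrite divr_gt0 ?mulr_gt0 //; lra.
  have e2 : e <= 2 * eps by rewrite ler_pdivrMr; nra.
  have er : 0 < e < branch_range n m by rewrite e0 /=; lra.
  have [v [lam [vE [v0 vx] [lam1 lamK] ev ev_unique]]] :=
    pitchfork_bifurcation m0 er pf.
  exists (coef_of v, lam) => _ /=.
  have JE : jacobianQ n.+2 c (coef_of v) =
      map_mx (real_complex R) (qjac (@diag_coef R n c) (@quad_coef R n c) v).
    by rewrite /jacobianQ trunc_coef_of jacobian_Qmap.
  have v1 : coef_of v 1%N = v 0 ord0 := coef_of_ord v ord0.
  case/andP: lam1 => lam56 lam1.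
  (* Since [eps < 1], errors of order [eps ^+ 2] are absorbed by [eps * Num.sqrt eps]. *)
  have sqe : eps <= Num.sqrt eps.
    rewrite -[leLHS](sqr_sqrtr (ltW eps_gt0)) expr2 ler_piMl ?sqrtr_ge0 //.
    by rewrite -[leRHS]sqrtr1 ler_wsqrtr //; lra.
  split; first split.
  - exact: stationary_coef_of (cN g1) vE.
  - move=> /(congr1 (fun f => f 1%N)); rewrite v1 /uniform_coef /= => vz.
    by move: v0; rewrite vz ltxx.
  - by move=> k; exact: coef_of_gt.
  - move=> z; rewrite JE => ez; rewrite norm_normc (_ : 1 = real_complex R 1) // ltcR.
    have [->|zl] := eqVneq z (real_complex R lam).
      by rewrite normc_real gtr0_norm; lra.
    by have := ev_unique _ ez zl; lra.
  - split; first by rewrite JE.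
    move=> w; rewrite JE !norm_normc ltcR normc_real => ew wl.
    by have := ev_unique _ ew wl; rewrite gtr0_norm; lra.
  - rewrite -[X in `|X - _|]/(coef_of v 1) v1.
    apply: le_trans (amplitude_expansion eps_gt0 m0 kap01 _ K0 L0
      (erefl e) _ _ mc v0 vx ck) _.
    + have := cb g1 2%N g01 isT; rewrite -/c ler_norml => /andP[_ ->].
      by rewrite (lt_le_trans m0 mc).
    + by rewrite -epsE.
    + by have /andP[] := pf_s pf.
    + by rewrite ler_wpM2r ?mulr_ge0 ?sqrtr_ge0 ?(ltW eps_gt0) // le_max lexx.
  - have -> : 1 - 8 / pi * eps = 1 - 2 * e.
      rewrite /e; have : pi != 0 :> R by lra.
      by generalize (@pi R) => P P0; field.
    apply: le_trans lamK _; rewrite -/K.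
    apply: (@le_trans _ _ (4 * K * (eps * Num.sqrt eps))).
      have -> : 4 * K * (eps * Num.sqrt eps) = K * (4 * (eps * Num.sqrt eps)) by ring.
      by rewrite ler_pM2l // expr2; nra.
    by rewrite ler_wpM2r ?mulr_ge0 ?sqrtr_ge0 ?(ltW eps_gt0) // le_max lexx orbT.
have [F FP] := choice ex_good.
have C0 : 0 < C by rewrite lt_max; apply/orP; right; rewrite mulr_gt0.
exists (pi / 4 + eps0); split.
  rewrite ltrDl eps00 /=; have : eps0 <= 1 - pi / 4 by rewrite !ge_min lexx !orbT.
  by lra.
have bigO_half (h : R -> R) : (forall g1, pi / 4 < g1 < pi / 4 + eps0 ->
      `|h g1| <= C * ((g1 - pi / 4) * Num.sqrt (g1 - pi / 4))) ->
    h =O_ ((pi / 4 : R)^'+) (fun g1 : R => (g1 - pi / 4) `^ (3 / 2)).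
  move=> hC; apply/eqO_exP; exists C => //; near=> g1.
  have gl : pi / 4 < g1 by near: g1; exact: nbhs_right_gt.
  have gu : g1 < pi / 4 + eps0 by near: g1; apply: nbhs_right_lt; rewrite ltrDl.
  rewrite powR_three_halves ?subr_gt0 // [X in _ <= _ * X]ger0_norm; last first.
    by rewrite mulr_ge0 ?sqrtr_ge0 // subr_ge0 ltW.
  by apply: hC; rewrite gl.
exists (fun g1 => (F g1).1), (fun g1 => (F g1).2); split.
- by move=> g1 /FP[].
- by apply: bigO_half => g1 /FP[].
- by apply: bigO_half => g1 /FP[].
Unshelve. all: by end_near. Qed.
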